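(* Let $\Omega\subset\mathbb{R}^d$ be a bounded open set, and let $\phi_n\in C^\infty(\Omega;\mathbb{R})$ and $h_n>0$, $h_n\to0$, be such that $-h_n^2\Delta\phi_n=\phi_n$ in $\Omega$, $\phi_n|_{\partial\Omega}=0$ and $\|\phi_n\|_{L^2(\Omega)}^2=\mathrm{Vol}(\Omega)$. Let $U\subset\Omega$ be a Borel set of positive Lebesgue measure, let $k\in\mathbb{N}$ and let $\mu\in\sigma_{k,U}((\phi_n)_n)$. Then $\mu$ is supported on $FP$, i.e. $\mu(\mathcal{H}^k\setminus FP)=0$.
   Context: $FP:=\{f\in C^\infty(\mathbb{R}^d;\mathbb{R}): -\Delta f=f\}$. For $k\in\mathbb{N}=\{0,1,2,\dots\}$, $\mathcal{H}^k$ is the space $C^k(\mathbb{R}^d)$ of real-valued functions with the metric $\boldsymbol{d}_k(f,g)=\inf\{\varepsilon>0:\|f-g\|_{C^k(B(0,\varepsilon^{-1}))}<\varepsilon\}$; it is a Polish space, and $FP$ is a closed subset of it. $\mathcal{C}_b(\mathcal{H}^k)$ is the space of bounded real-valued continuous functions on $\mathcal{H}^k$, and $\mathcal{M}^k$ the space of finite signed Borel measures on $\mathcal{H}^k$. The condition $\phi_n|_{\partial\Omega}=0$ is the Dirichlet condition ($\phi_n$ is an eigenfunction of the Dirichlet Laplacian of $\Omega$, in $H^1_0(\Omega)$). Fix a decreasing function $\chi\in C_c^\infty([0,\infty);[0,1])$ equal to $1$ near the origin and vanishing outside $[0,1]$. For $x_0\in\Omega$ set $\tilde\phi_{x_0,n}(y):=\phi_n(x_0+h_ny)\,\chi\big(\frac{h_n|y|}{d(x_0,\partial\Omega)}\big)$,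 $y\in\mathbb{R}^d$ (understood as $0$ where the cutoff vanishes). Define $LM_{k,U}(\phi_n):=\frac1{\mathrm{Vol}(U)}\int_U\delta_{\tilde\phi_{x_0,n}}\,dx_0$, a probability measure in $\mathcal{M}^k$. $\sigma_{k,U}((\phi_n)_n)$ is the set of accumulation points in $\mathcal{M}^k$ of the sequence $(LM_{k,U}(\phi_n))_n$ for the weak-* topology, i.e. for convergence tested against all $F\in\mathcal{C}_b(\mathcal{H}^k)$. *)

(* Defs.v *)
From HB Require Import structures.
From mathcomp Require Import all_boot all_order all_algebra.
From mathcomp Require Import all_classical all_reals all_analysis.

Set Implicit Arguments.
Unset Strict Implicit.
Unset Printing Implicit Defensive.

Import Order.TTheory GRing.Theory Num.Theory.
Import numFieldNormedType.Exports.

Local Open Scope classical_set_scope.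
Local Open Scope ring_scope.

HB.instance Definition _ (R : realType) (d : nat) :=
  @isMeasurable.Build (sigma_display (@open 'rV[R]_d)) 'rV[R]_d
    <<s @open 'rV[R]_d >> (@sigma_algebra0 _ setT _)
    (@sigma_algebraC _ _) (@sigma_algebra_bigcup _ setT _).

Section lebesgue_rV.
Context {R : realType}.

Lemma rV_open_bigcup n (A : set 'rV[R]_n) : open A ->
  A = \bigcup_(p : 'rV[rat]_n * nat)
    [set x | (forall y : 'rV[R]_n,
               (forall i, `|ratr (p.1 0 i) - y 0 i| < p.2.+1%:R^-1) -> A y) /\
             (forall i, `|ratr (p.1 0 i) - x 0 i| < p.2.+1%:R^-1)].
Proof.
move=> oA; apply/seteqP; split => [x Ax|x [p _ [h1 h2]]]; last exact: h1.
have /nbhs_ballP[e /= e0 eA] : nbhs x A by exact: open_nbhs_nbhs.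
have [m me] : exists m : nat, m.+1%:R^-1 < e / 2 :> R.
  have /ltr_add_invr[m] : 0 < e / 2 by rewrite divr_gt0.
  by rewrite add0r => ?; exists m.
have hq (i : 'I_n) : exists q : rat, `|ratr q - x 0 i| < m.+1%:R^-1 :> R.
  have [q] : exists q : rat, ratr q \in `]x 0 i - m.+1%:R^-1, x 0 i + m.+1%:R^-1[.
    by apply: rat_in_itvoo; rewrite ltrD2l gt0_cp.
  rewrite in_itv/= => qi; exists q; move: qi.
  by rewrite ltr_distl.
pose q : 'rV[rat]_n := \row_i projT1 (cid (hq i)).
have qE i : `|ratr (q 0 i) - x 0 i| < m.+1%:R^-1 :> R.
  by rewrite /q mxE; case: cid.
exists (q, m) => //=; split => // y qy; apply: eA; split => // i j.
rewrite (ord1 i) /ball/= (le_lt_trans (ler_distD (ratr (q 0 j)) _ _))//.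
by rewrite (splitr e) ltrD// ?(lt_trans _ me)// distrC.
Qed.

Lemma measurable_fun_rV d (T : measurableType d) n (f : T -> 'rV[R]_n) :
  (forall i, measurable_fun [set: T] (fun t => f t 0 i)) ->
  measurable_fun [set: T] f.
Proof.
move=> mf; apply: (@measurability _ _ _ _ _ _ (@open 'rV[R]_n)) => //.
move=> _ [A oA <-]; rewrite setTI (rV_open_bigcup oA) preimage_bigcup.
apply: countable_bigcupT_measurable; first exact: countableP.
move=> [q m] /=.
have [qA|/asboolPn nqA] := pselect (forall y : 'rV[R]_n,
    (forall i, `|ratr (q 0 i) - y 0 i| < m.+1%:R^-1) -> A y); last first.
  rewrite (_ : _ @^-1` _ = set0); first exact: measurable0.
  by apply/seteqP; split => // t [/asboolP]; rewrite (negbTE nqA).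
rewrite (_ : _ @^-1` _ = \bigcap_(i in [set: 'I_n])
    ((fun t => f t 0 i) @^-1` ball (ratr (q 0 i) : R) m.+1%:R^-1)); last first.
  apply/seteqP; split => [t [_ h] i _|t h]; first exact: h.
  by split => // i; exact: h.
apply: fin_bigcap_measurable => // i _.
by rewrite -[_ @^-1` _]setTI; apply: mf => //; exact: measurable_realfun.measurable_ball.
Qed.

Lemma measurable_coord n (i : 'I_n) :
  measurable_fun [set: 'rV[R]_n] (fun x => x 0 i).
Proof.
apply: (measurability _ (measurable_realfun.RGenOpens.measurableE R)) => _ [_ [a [b ->]] <-].
rewrite setTI; apply: sub_sigma_algebra.
by apply: open_comp; [move=> x _; exact: coord_continuous|exact: interval_open].
Qed.

Definition rV_cons n (p : 'rV[R]_n * R) : 'rV[R]_n.+1 :=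
  \row_i (if unlift ord0 i is Some j then p.1 0 j else p.2).

Lemma measurable_rV_cons n : measurable_fun [set: 'rV[R]_n * R] (@rV_cons n).
Proof.
apply: measurable_fun_rV => i; rewrite /rV_cons.
under eq_fun do rewrite mxE.
case: unliftP => [j|] _; last exact: measurable_snd.
exact: measurableT_comp (measurable_coord j) measurable_fst.
Qed.

Definition lebesgue_rV_step n (m : {measure set 'rV[R]_n -> \bar R}) :
  set 'rV[R]_n.+1 -> \bar R :=
  pushforward (m \x lebesgue_measure)%E (@rV_cons n).

HB.instance Definition _ n (m : {measure set 'rV[R]_n -> \bar R}) :=
  Measure.copy (lebesgue_rV_step m)
    (measure_function_pushforward__canonical__measure_function_Measure
      (m \x lebesgue_measure)%E (@measurable_rV_cons n)).

Fixpoint lebesgue_rV n : {measure set 'rV[R]_n -> \bar R} :=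
  if n is n'.+1 then lebesgue_rV_step (lebesgue_rV n') else dirac (0 : 'rV[R]_0).

End lebesgue_rV.

Section calculus.
Context {R : realType} {d : nat}.
Implicit Types (f g : 'rV[R]_d -> R) (A : set 'rV[R]_d) (s : seq 'I_d) (k : nat).

(* The library norm on 'rV[R]_d is the sup norm; |x| is the Euclidean one. *)
Definition enorm (x : 'rV[R]_d) : R := Num.sqrt (\sum_i x 0 i ^+ 2).

Lemma enorm0 : enorm 0 = 0.
Proof. by rewrite /enorm big1 ?sqrtr0// => i _; rewrite mxE expr0n. Qed.

Lemma coord_le_enorm (x : 'rV[R]_d) i : `|x 0 i| <= enorm x.
Proof.
rewrite -sqrtr_sqr ler_sqrt ?sumr_ge0//; last by move=> *; exact: sqr_ge0.
by rewrite (bigD1 i)//= lerDl sumr_ge0// => *; exact: sqr_ge0.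
Qed.

Definition eball (r : R) : set 'rV[R]_d := [set x | enorm x < r].

Definition pderiv (i : 'I_d) f : 'rV[R]_d -> R :=
  fun x => 'D_(delta_mx 0 i) f x.

(* Multi-indices are encoded as sequences of directions. *)
Definition pderivs s f : 'rV[R]_d -> R := foldr pderiv f s.

Definition Ck k A f : Prop := forall s, (size s <= k)%N ->
  (forall x, A x -> {for x, continuous (pderivs s f)}) /\
  ((size s < k)%N -> forall i x, A x ->
     derivable (pderivs s f) x (delta_mx 0 i)).

Definition smooth A f : Prop := forall k, Ck k A f.

Definition laplacian f : 'rV[R]_d -> R :=
  fun x => \sum_i pderiv i (pderiv i f) x.

Definition Ck_norm k A f : \bar R :=
  ereal_sup [set y | exists s x, [/\ (size s <= k)%N, A x &
    y = `|pderivs s f x|%:E]].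

Lemma pderivsB k f g s : Ck k setT f -> Ck k setT g -> (size s <= k)%N ->
  pderivs s (f \- g) = pderivs s f \- pderivs s g.
Proof.
move=> kf kg; elim: s => // i s ih /= sk.
rewrite ih ?(ltnW sk)//; apply/funext => x; rewrite /pderiv.
by rewrite deriveB//; [apply: (kf s _).2|apply: (kg s _).2]; rewrite // ltnW.
Qed.

Lemma pderivs0 s : pderivs s (fun=> 0) = fun=> 0.
Proof.
elim: s => //= i s ->; apply/funext => x; rewrite /pderiv.
exact: (@derive_cst R 'rV[R]_d R).
Qed.

Lemma Ck0 k : Ck k setT (fun=> 0).
Proof.
move=> s sk; rewrite pderivs0; split => [x _|_ i x _].
  exact: cst_continuous.
exact: (@derivable_cst R 'rV[R]_d R).
Qed.

End calculus.

Record Hk (R : realType) (d k : nat) := MkHk {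
  Hk_fun :> 'rV[R]_d -> R ;
  _ : `[< Ck k setT Hk_fun >] }.

HB.instance Definition _ R d k := [isSub for @Hk_fun R d k].
HB.instance Definition _ R d k := [Choice of Hk R d k by <:].

Section Hk_metric.
Context {R : realType} {d k : nat}.
Implicit Types f g h : Hk R d k.

Lemma HkP f : Ck k setT f.
Proof. by case: f => f /= /asboolP. Qed.

Definition Hk0 : Hk R d k := MkHk (asboolT (@Ck0 R d k)).

HB.instance Definition _ := isPointed.Build (Hk R d k) Hk0.

Definition dk_set f g : set R :=
  [set e | 0 < e /\ (Ck_norm k (eball e^-1) (f \- g)%R < e%:E)%E].

Definition dk f g : R := inf (dk_set f g).

Lemma dk_set_bound f g e : dk_set f g e ->
  exists2 M, M < e & forall s x, (size s <= k)%N -> enorm x < e^-1 ->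
    `|pderivs s f x - pderivs s g x| <= M.
Proof.
move=> [e0 fge]; set N := Ck_norm _ _ _ in fge.
have N_ge s x : (size s <= k)%N -> enorm x < e^-1 ->
    (`|pderivs s f x - pderivs s g x|%:E <= N)%E.
  move=> sk xe; apply: ereal_sup_ubound; exists s, x; split => //.
  by rewrite (pderivsB (HkP f) (HkP g) sk).
have N0 : (0 <= N)%E.
  apply: le_trans (N_ge [::] 0 _ _); rewrite ?lee_fin//.
  by rewrite enorm0 invr_gt0.
have NE : N = (fine N)%:E by rewrite fineK// ge0_fin_numE// (lt_trans fge) ?ltry.
by exists (fine N) => [|s x sk xe]; rewrite -?lte_fin -?lee_fin -NE//; exact: N_ge.
Qed.

Lemma Ck_norm_le f g e M :
  (forall s x, (size s <= k)%N -> enorm x < e^-1 ->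
    `|pderivs s f x - pderivs s g x| <= M) ->
  (Ck_norm k (eball e^-1) (f \- g)%R <= M%:E)%E.
Proof.
move=> h; apply: ge_ereal_sup => _ [s [x [sk xe ->]]].
by rewrite (pderivsB (HkP f) (HkP g) sk) lee_fin; exact: h.
Qed.

Lemma dk_set_nonempty f g : dk_set f g !=set0.
Proof.
pose D (s : seq 'I_d) x := `|pderivs s f x - pderivs s g x|.
pose M := 1 + \sum_(t : {bseq k of 'I_d}) D t 0.
have M0 : 0 < M.
  by rewrite ltr_pwDl// sumr_ge0// => t _; exact: normr_ge0.
have near_t (t : {bseq k of 'I_d}) : \forall x \near (0 : 'rV[R]_d), D t x <= M.
  have cD : {for (0 : 'rV[R]_d), continuous (D t)}.
    apply: continuous_comp; last exact: norm_continuous.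
    apply: continuousB.
      exact: (HkP f (size_bseq t)).1.
    exact: (HkP g (size_bseq t)).1.
  have D0M : D t 0 < M.
    rewrite /M (bigD1 t)//= addrCA ltrDl ltr_pwDl// sumr_ge0//.
    by move=> i _; exact: normr_ge0.
  by near do apply/ltW; exact: (cvgr_lt _ cD).
have /nbhs_ballP[r /= r0 rD] := filter_forall (nbhs_filter (0 : 'rV[R]_d)) near_t.
pose e := Num.max (M + 1) r^-1.
have e0 : 0 < e by rewrite lt_max addr_gt0.
exists e; split => //; apply: (@le_lt_trans _ _ M%:E).
  apply: Ck_norm_le => s x sk xe; apply: (rD x _ (Bseq sk)).
  split => // i j; rewrite (ord1 i) mxE /ball/= sub0r normrN.
  rewrite (le_lt_trans (coord_le_enorm _ _))// (lt_le_trans xe)//.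
  by rewrite invf_ple ?posrE// le_max lexx orbT.
by rewrite lte_fin lt_max ltrDl ltr01.
Unshelve. all: by end_near. Qed.

Lemma dk_lt f g e : dk f g < e -> exists2 e', dk_set f g e' & e' < e.
Proof. by move=> /(inf_lt (dk_set_nonempty f g)) [e' ? ?]; exists e'. Qed.

Lemma dk_le f g e : dk_set f g e -> dk f g <= e.
Proof. by move=> fge; apply: ge_inf => //; exists 0 => ? [/ltW]. Qed.

Lemma dk_ge0 f g : 0 <= dk f g.
Proof. by apply: lb_le_inf; [exact: dk_set_nonempty|move=> e [/ltW]]. Qed.

Lemma dkxx f : dk f f = 0.
Proof.
apply/eqP; rewrite eq_le dk_ge0 andbT; apply/ler_addgt0Pl => e e0.
rewrite addr0; apply: dk_le; split => //.
apply: (@le_lt_trans _ _ 0%:E); last by rewrite lte_fin.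
by apply: Ck_norm_le => s x _ _; rewrite subrr normr0.
Qed.

Lemma dk_positivity f g : dk f g = 0 -> f = g.
Proof.
move=> fg0; apply/val_inj/funext => x /=; apply/eqP; rewrite -subr_eq0.
rewrite -normr_eq0 eq_le normr_ge0 andbT; apply/ler_addgt0Pl => e e0.
rewrite addr0.
have x1 : 0 < enorm x + 1 by rewrite ltr_wpDl// sqrtr_ge0.
have [|e' [e'0 fge']] := @dk_lt f g (Num.min e (enorm x + 1)^-1).
  by rewrite fg0 lt_min e0 invr_gt0.
rewrite lt_min => /andP[e'e e'x]; apply/ltW/(lt_trans _ e'e).
have [M Me' fgM] := dk_set_bound (conj e'0 fge').
apply: (le_lt_trans (fgM [::] x _ _)) => //.
by rewrite (@lt_trans _ _ (enorm x + 1)) ?ltrDl// -ltf_pV2 ?posrE ?invr_gt0// invrK.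
Qed.

Lemma dk_setC f g : dk_set f g `<=` dk_set g f.
Proof.
move=> e [e0 fge]; split => //; apply: le_lt_trans fge.
apply: ge_ereal_sup => _ [s [x [sk xe ->]]]; apply: ereal_sup_ubound.
exists s, x; split => //.
rewrite (pderivsB (HkP f) (HkP g) sk) (pderivsB (HkP g) (HkP f) sk).
by rewrite /= distrC.
Qed.

Lemma dkC f g : dk f g = dk g f.
Proof. by rewrite /dk; congr inf; apply/seteqP; split; exact: dk_setC. Qed.

Lemma dk_triangle g f h : dk f h <= dk f g + dk g h.
Proof.
apply/ler_addgt0Pr => e e0.
have e20 : 0 < e / 2 by rewrite divr_gt0.
have [|e1 [e10 fg] e1e] := @dk_lt f g (dk f g + e / 2); first by rewrite ltrDl.
have [|e2 [e20' gh] e2e] := @dk_lt g h (dk g h + e / 2); first by rewrite ltrDl.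
apply: (@le_trans _ _ (e1 + e2)); last first.
  by rewrite (splitr e) addrACA lerD// ltW.
have e12 : 0 < e1 + e2 by rewrite addr_gt0.
have inv1 : (e1 + e2)^-1 <= e1^-1 by rewrite lef_pV2 ?posrE// lerDl ltW.
have inv2 : (e1 + e2)^-1 <= e2^-1 by rewrite lef_pV2 ?posrE// lerDr ltW.
apply: dk_le; split => //.
have [M1 M1e fgM] := dk_set_bound (conj e10 fg).
have [M2 M2e ghM] := dk_set_bound (conj e20' gh).
apply: (@le_lt_trans _ _ (M1 + M2)%:E); last by rewrite lte_fin ltrD.
apply: Ck_norm_le => s x sk xe.
by rewrite (le_trans (ler_distD (pderivs s g x) _ _))// lerD// ?fgM ?ghM// (lt_le_trans xe).
Qed.

HB.instance Definition _ :=
  @isMetric.Build R (Hk R d k) dk dkxx dk_positivity dkC dk_triangle.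

HB.instance Definition _ :=
  @isMeasurable.Build (sigma_display (@open (Hk R d k))) (Hk R d k)
    <<s @open (Hk R d k) >> (@sigma_algebra0 _ setT _)
    (@sigma_algebraC _ _) (@sigma_algebra_bigcup _ setT _).

End Hk_metric.

Section charge_integral.
Context d (T : measurableType d) (R : realType).
Implicit Types (nu : {charge set T -> \bar R}) (F : T -> R).

(* By uniqueness of the Hahn decomposition up to null sets, the value does not
   depend on the decomposition that is chosen. *)
Definition charge_integral nu F : \bar R :=
  let hahn := svalP (cid (Hahn_decomposition nu)) in
  let nuPN := svalP (cid hahn) in
  (\int[jordan_pos nuPN]_x (F x)%:E - \int[jordan_neg nuPN]_x (F x)%:E)%E.

End charge_integral.

Section local_measures.
Context {R : realType} {d : nat}.
Implicit Types (Omega U : set 'rV[R]_d) (f : 'rV[R]_d -> R) (chi : R -> R).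

Definition boundary Omega : set 'rV[R]_d := closure Omega `\` Omega°.

Definition dist_boundary Omega (x : 'rV[R]_d) : R :=
  inf [set enorm (x - z) | z in boundary Omega].

(* C^infty_c(Omega) *)
Definition test_function Omega f : Prop :=
  [/\ smooth setT f,
      compact (closure [set x | f x != 0]) &
      closure [set x | f x != 0] `<=` Omega].

(* Membership in H^1_0(Omega), the closure of C^infty_c(Omega) for the H^1 norm,
   of a function f that is smooth in Omega: the weak gradient of f is then its
   classical gradient. *)
Definition H10 Omega f : Prop :=
  exists psi : nat -> 'rV[R]_d -> R,
  [/\ forall j, test_function Omega (psi j),
      (\int[lebesgue_rV d]_(x in Omega) ((psi j x - f x) ^+ 2)%:E)%E
        @[j --> \oo] --> 0%E &
      forall i, (\int[lebesgue_rV d]_(x in Omega)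
          ((pderiv i (psi j) x - pderiv i f x) ^+ 2)%:E)%E
        @[j --> \oo] --> 0%E].

(* Only the values of chi on [0, +oo[ matter.  As chi is constant near 0, its
   smoothness on [0, +oo[ amounts to its smoothness on ]0, +oo[. *)
Definition cutoff chi : Prop :=
  [/\ forall t, 0 <= t -> 0 <= chi t <= 1,
      forall s t, 0 <= s -> s <= t -> chi t <= chi s,
      exists2 e, 0 < e & forall t, 0 <= t < e -> chi t = 1,
      forall t, 1 < t -> chi t = 0 &
      forall n t, 0 < t -> derivable (derive1n n chi) t 1].

(* When the cutoff is nonzero, h * |y| < dist_boundary Omega x0, so that
   x0 + h *: y lies in Omega; the values of phi outside Omega are irrelevant. *)
Definition localized chi Omega (phi : 'rV[R]_d -> R) (h : R) (x0 : 'rV[R]_d) :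
    'rV[R]_d -> R :=
  fun y => phi (x0 + h *: y) * chi (h * enorm y / dist_boundary Omega x0).

(* The functions to which this is applied are C^infty, so that the default
   value 0 is never taken. Where h * |y| = dist_boundary Omega x0 this is because
   chi vanishes to infinite order at 1 while, by interior estimates, the
   derivatives of an eigenfunction grow at most polynomially near the boundary. *)
Definition to_Hk k f : Hk R d k := insubd (Hk0 : Hk R d k) f.

(* A bare set function: its countable additivity would require the measurability
   of x0 |-> localized ... x0, which depends on the hypotheses made on phi. *)
Definition LM k U chi Omega phi (h : R) : set (Hk R d k) -> \bar R :=
  fun B => ((fine (lebesgue_rV d U))^-1%:E *
    \int[lebesgue_rV d]_(x0 in U)
      \d_(to_Hk k (localized chi Omega phi h x0)) B)%E.

Arguments LM : clear implicits.

(* Accumulation points for the topology generated by the functionals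
   nu |-> \int F dnu, F bounded and continuous: each basic neighborhood of mu
   contains LM_n for infinitely many n. *)
Definition sigma_LM k U chi Omega (phi : nat -> 'rV[R]_d -> R) (h : nat -> R) :
    set ({charge set (Hk R d k) -> \bar R})%R :=
  [set mu | forall m (F : 'I_m -> Hk R d k -> R) (e : R) (N : nat),
    (forall i, continuous (F i) /\ bounded_fun (F i)) -> 0 < e ->
    exists2 n, (N <= n)%N & forall i,
      (`| \int[LM k U chi Omega (phi n) (h n)]_f (F i f)%:E
          - charge_integral mu (F i) | < e%:E)%E].

Definition FP k : set (Hk R d k) :=
  [set f | smooth setT f /\ forall x, - laplacian f x = f x].

End local_measures.

Arguments LM {R d} k U chi Omega phi h _.
Arguments sigma_LM {R d} k U chi Omega phi h _.
Arguments FP {R d} k _.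

(* Main.v *)
(* Let A_m be the set of the f in H^k that solve -Delta f = f in the ball of
   radius m, and F_m(f) = min(1, m dist(f, A_m)), a bounded continuous function.

   - As n grows, the localized eigenfunction at x0 belongs to A_m as soon as x0 is
     not too close to the boundary, because the cutoff is then equal to 1 on the
     ball of radius m; hence the integral of F_m against LM(phi_n) tends to 0, and
     the integral of F_m against mu vanishes.
   - F_m increases to the indicator of the complement of FP.  Indeed a locally
     uniform limit of solutions is a smooth solution, by an interior gradient
     estimate |d_i u| <= C sup |u|.  The latter is Bernstein's: on the ball of
     radius rho, with eta = rho^2 - |x|^2 and v = d_i u, the function
       eta^2 v^2 + lam u^2 + gam |x|^2
     is strictly subharmonic for lam, gam large, so that it is bounded by its
     values on the sphere, where eta = 0.

   Monotone convergence for the Jordan parts of mu concludes. *)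
Require Import Defs.
From HB Require Import structures.
From mathcomp Require Import all_boot all_order all_algebra.
From mathcomp Require Import finmap.
From mathcomp Require Import all_classical all_reals all_analysis.
From mathcomp Require Import ring lra.
Import Order.TTheory GRing.Theory Num.Theory.
Import numFieldNormedType.Exports.
Local Open Scope classical_set_scope.
Local Open Scope ring_scope.

Set Implicit Arguments.
Unset Strict Implicit.
Unset Printing Implicit Defensive.

(** * Directional derivatives *)

Lemma near_eq_continuous (T U : topologicalType) (f g : T -> U) x :
  {near x, f =1 g} -> {for x, continuous f} -> {for x, continuous g}.
Proof.
move=> fg cf; rewrite /prop_for /continuous_at -(nbhs_singleton fg).
by apply: cvg_trans cf; apply: near_eq_cvg; exact: fg.
Qed.

Lemma continuous_affine (R : realType) (V : normedModType R) (a : V) (r : R) :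
  continuous (fun y : V => a + r *: y).
Proof.
move=> x; apply: (@continuousD _ _ _ (fun=> a) (fun y => r *: y)).
  exact: cst_continuous.
by apply: continuousZl_tmp; exact: cvg_id.
Qed.

Lemma continuous_at_dist (R : realType) (V : normedModType R) (f : V -> R) x :
  (forall e : R, 0 < e -> \forall y \near x, `|f x - f y| <= e) ->
  {for x, continuous f}.
Proof. by move=> h; apply/cvgrPdist_le. Qed.

Section directional_derivatives.
Context {R : realType} {V : normedModType R}.
Implicit Types (f : V -> R) (x v w : V) (s t : R).

Lemma is_derive_line f x v t : derivable f (t *: v + x) v ->
  is_derive t 1 (fun s => f (s *: v + x)) ('D_v f (t *: v + x)).
Proof.
have E : (fun h => h^-1 *: (((fun s => f (s *: v + x)) \o shift t) (h *: 1)
      - f (t *: v + x))) =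
    (fun h => h^-1 *: ((f \o shift (t *: v + x)) (h *: v) - f (t *: v + x))).
  apply/funext => h /=.
  by rewrite [h *: 1]mulr1 scalerDl addrA.
by move=> df; apply: DeriveDef; rewrite /derivable /derive E.
Qed.

Lemma is_derive_translate f a x v : derivable f (a + x) v ->
  is_derive x v (fun y => f (a + y)) ('D_v f (a + x)).
Proof.
have E : (fun h => h^-1 *: (((fun y => f (a + y)) \o shift x) (h *: v)
      - f (a + x))) =
    (fun h => h^-1 *: ((f \o shift (a + x)) (h *: v) - f (a + x))).
  by apply/funext => h /=; rewrite addrCA.
by move=> df; apply: DeriveDef; rewrite /derivable /derive E.
Qed.

(** Only a derivative along [v] is available, so the one-variable chain rule is applied on a line:
    moving [x] by h v moves a + r x by (r h) v. *)
Lemma is_derive_affine f a r x v : derivable f (a + r *: x) v ->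
  is_derive x v (fun y => f (a + r *: y)) (r * 'D_v f (a + r *: x)).
Proof.
move=> df.
pose g s := f (s *: v + (a + r *: x)).
have dg : is_derive (r *: 0 : R) 1 g ('D_v f (a + r *: x)).
  have := @is_derive_line f (a + r *: x) v 0.
  by rewrite scaler0 scale0r add0r; apply.
have dh : is_derive (0 : R) 1 (fun s => g (r * s)) (r * 'D_v f (a + r *: x)).
  have dr : is_derive (0 : R) 1 (fun s => r *: s) (r *: 1) by exact: is_deriveZ.
  have := @is_derive1_comp _ g (fun s => r *: s) 0 _ _ dg dr.
  by rewrite [r *: 1]mulr1 mulrC.
have E : (fun h => h^-1 *: (((fun y => f (a + r *: y)) \o shift x) (h *: v)
      - f (a + r *: x))) =
    (fun h => h^-1 *: (((fun s => g (r * s)) \o shift 0) (h *: 1) - g (r * 0))).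
  apply/funext => h /=; rewrite /g addr0 [h *: 1]mulr1 mulr0 scale0r add0r.
  by rewrite [r *: (_ + _)]scalerDr addrCA scalerA.
apply: DeriveDef; rewrite /derivable /derive E; first exact: (@ex_derive _ _ _ _ _ _ _ dh).
exact: (@derive_val _ _ _ _ _ _ _ dh).
Qed.

(** Stated for [t] of either sign, as difference quotients require; the one-variable theorem is used
    on [0, t] or on [t, 0]. *)
Lemma MVT_line f x v t :
  (forall s, `|s| <= `|t| -> derivable f (s *: v + x) v) ->
  exists2 s, `|s| <= `|t| &
    f (t *: v + x) - f x = t * 'D_v f (s *: v + x).
Proof.
move=> df; pose g s := f (s *: v + x).
have dg s : `|s| <= `|t| -> is_derive s 1 g ('D_v f (s *: v + x)).
  by move=> st; apply: is_derive_line; exact: df.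
have gE : f x = g 0 by rewrite /g scale0r add0r.
have [t0|t0] := leP 0 t.
  have [||s] := @MVT_segment _ g (fun s => 'D_v f (s *: v + x)) 0 t t0.
  - move=> s; rewrite in_itv/= => /andP[s0 st]; apply: dg.
    by rewrite !ger0_norm// ltW.
  - apply: derivable_within_continuous => s; rewrite in_itv/= => /andP[s0 st].
    by have [] := dg s; rewrite ?ger0_norm.
  rewrite in_itv/= => /andP[s0 st] E; exists s; first by rewrite !ger0_norm.
  by rewrite gE E subr0 mulrC.
have [||s] := @MVT_segment _ g (fun s => 'D_v f (s *: v + x)) t 0 (ltW t0).
- move=> s; rewrite in_itv/= => /andP[s0 st]; apply: dg.
  by rewrite !ler0_norm ?lerN2// ltW.
- apply: derivable_within_continuous => s; rewrite in_itv/= => /andP[s0 st].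
  by have [] := dg s; rewrite ?ler0_norm ?lerN2// ltW.
rewrite in_itv/= => /andP[s0 st] E.
exists s; first by rewrite !ler0_norm ?lerN2// ltW.
by rewrite gE -opprB E sub0r mulrN opprK mulrC.
Qed.

Lemma near_dist x (P : set V) : (\forall y \near x, P y) ->
  exists2 r, 0 < r & forall y, `|x - y| < r -> P y.
Proof. by move=> /nbhs_normP[r /= r0 rP]; exists r. Qed.

Lemma near_line x v (P : V -> Prop) : (\forall y \near x, P y) ->
  exists2 e, 0 < e & forall t, `|t| <= e -> P (t *: v + x).
Proof.
move=> /near_dist[r r0 rP].
have v1 : 0 < `|v| + 1 by rewrite ltr_wpDl.
(* Adding 1 covers v = 0, and the factor 2 leaves room for a strict inequality. *)
exists (r / (2 * (`|v| + 1))); first by rewrite divr_gt0// mulr_gt0.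
move=> t te; apply: rP => /=; rewrite opprD addrCA subrr addr0 normrN normrZ.
apply: (@le_lt_trans _ _ (r / (2 * (`|v| + 1)) * (`|v| + 1))).
  by rewrite ler_pM// lerDl.
by rewrite invfM mulrA -mulrA mulVf ?gt_eqF// mulr1 ltr_pdivrMr// ltr_pMr// ltr1n.
Qed.

(** The first derivative vanishes at the maximum; if the second were positive, the first would be
    positive just after [x], and by the mean value theorem [f] would exceed f(x) there. *)
Lemma second_derivative_test f x v :
  (\forall y \near x, derivable f y v) -> derivable ('D_v f) x v ->
  (\forall y \near x, f y <= f x) -> 'D_v ('D_v f) x <= 0.
Proof.
move=> ndf ddf fx; rewrite leNgt; apply/negP => L0.
have [e e0 eP] := near_line v (filterI ndf fx).
have d0 : 'D_v f x = 0.
  have := @derive1_at_max R (fun s => f (s *: v + x)) (- e) e 0.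
  case.
  - by rewrite ge0_cp// ltW.
  - move=> t; rewrite in_itv/= => /andP[t1 t2].
    have /eP[df _] : `|t| <= e by rewrite ler_norml !ltW.
    by have [] := is_derive_line df.
  - by rewrite in_itv/= oppr_lt0 e0.
  - move=> t; rewrite in_itv/= => /andP[t1 t2]; rewrite scale0r add0r.
    by have /eP[] : `|t| <= e by rewrite ler_norml !ltW.
  have := @is_derive_line f x v 0; rewrite scale0r add0r => /(_ (nbhs_singleton ndf)).
  by move=> [_ <-].
have : \forall h \near 0^', 0 < h^-1 *: (('D_v f \o shift x) (h *: v) - 'D_v f x).
  exact: (cvgr_gt _ ddf).
rewrite d0 /= => /nbhs_ballP[r /= r0 rP].
pose t := Num.min e (r / 2).
have t0 : 0 < t by rewrite lt_min e0 divr_gt0.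
have te : t <= e by rewrite ge_min lexx.
have tr : t < r by rewrite /t gt_min ltr_pdivrMr// ltr_pMr// ltr1n orbT.
have [||s] := @MVT _ (fun s => f (s *: v + x)) (fun s => 'D_v f (s *: v + x)) 0 t t0.
- move=> s; rewrite in_itv/= => /andP[s0 st]; apply: is_derive_line.
  by apply: (eP _ _).1; rewrite ger0_norm ?ltW// (lt_le_trans st).
- apply: derivable_within_continuous => s; rewrite in_itv/= => /andP[s0 st].
  have /eP[/is_derive_line[]//] : `|s| <= e by rewrite ger0_norm// (le_trans st).
rewrite in_itv/= => /andP[s0 st]; rewrite scale0r add0r subr0 => E.
have sr : ball 0 r s by rewrite /ball/= sub0r normrN gtr0_norm// (lt_trans st).
have := rP s sr (lt0r_neq0 s0); rewrite subr0.
rewrite pmulr_rgt0 ?invr_gt0// => s1.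
have /eP[_] : `|t| <= e by rewrite ger0_norm// ltW.
by rewrite -subr_le0 E leNgt pmulr_lgt0// s1.
Qed.

(** The mean value theorem twice: along [v] for y |-> f(t w + y) - f(y), then along [w] for D_v
    f. *)
Lemma second_difference f x v w t :
  (forall s r, `|s| <= `|t| -> `|r| <= `|t| ->
    derivable f (r *: w + (s *: v + x)) v /\
    derivable ('D_v f) (r *: w + (s *: v + x)) w) ->
  exists s r, [/\ `|s| <= `|t|, `|r| <= `|t| &
    f (t *: w + (t *: v + x)) - f (t *: v + x) - (f (t *: w + x) - f x) =
    t * (t * 'D_w ('D_v f) (r *: w + (s *: v + x)))].
Proof.
move=> df; pose g y := f (t *: w + y) - f y.
have dg s : `|s| <= `|t| -> is_derive (s *: v + x) v g
    ('D_v f (t *: w + (s *: v + x)) - 'D_v f (s *: v + x)).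
  move=> st; apply: is_deriveB; first exact: is_derive_translate (df _ _ st (lexx _)).1.
  apply: derivableP; have := (df s 0 st _).1; rewrite scale0r add0r.
  by apply; rewrite normr0.
have [|s st E] := @MVT_line g x v t; first by move=> s /dg[].
have [|r rt E'] := @MVT_line ('D_v f) (s *: v + x) w t.
  by move=> r rt; exact: (df _ _ st rt).2.
exists s, r; split => //; rewrite -E' -[LHS]/(g _ - g _) E; congr (_ * _).
by have [_ ->] := dg _ st.
Qed.

(** Schwarz's theorem: the second difference is symmetric in [v] and [w], and it is t^2 times either
    mixed derivative at a point near [x]; continuity of both at [x] concludes. *)
Lemma derive_comm f x v w :
  (\forall y \near x, [/\ derivable f y v, derivable f y w,
     derivable ('D_v f) y w & derivable ('D_w f) y v]) ->
  {for x, continuous ('D_w ('D_v f))} -> {for x, continuous ('D_v ('D_w f))} ->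
  'D_w ('D_v f) x = 'D_v ('D_w f) x.
Proof.
move=> df c1 c2; apply/eqP; rewrite -subr_eq0 -normr_eq0 eq_le normr_ge0 andbT.
apply/ler_addgt0Pl => e e0; rewrite addr0.
have aux (a b p q : R) : p = q -> `|a - p| < e / 2 -> `|b - q| < e / 2 ->
    `|a - b| <= e.
  move=> -> h1 h2; rewrite (le_trans (ler_distD q _ _))// (splitr e).
  by rewrite lerD ?ltW// distrC.
have e2 : 0 < e / 2 by rewrite divr_gt0.
have n1 : \forall y \near x, `|'D_w ('D_v f) x - 'D_w ('D_v f) y| < e / 2.
  exact: cvgr_dist_lt c1 _ e2.
have n2 : \forall y \near x, `|'D_v ('D_w f) x - 'D_v ('D_w f) y| < e / 2.
  exact: cvgr_dist_lt c2 _ e2.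
have [r r0 rP] := near_dist (filterI df (filterI n1 n2)).
pose N := `|v| + `|w| + 1.
have N0 : 0 < N by rewrite ltr_wpDl// addr_ge0.
(* Here t N = r / 2, so all intermediate points are at distance less than [r] from [x]. *)
pose t := r / N / 2.
have t0 : 0 < t by rewrite !divr_gt0.
have near_x s1 s2 : `|s1| <= `|t| -> `|s2| <= `|t| -> `|x - (s1 *: w + (s2 *: v + x))| < r.
  rewrite (gtr0_norm t0) => h1 h2; rewrite addrA opprD addrCA subrr addr0 normrN.
  rewrite (le_lt_trans (ler_normD _ _))// !normrZ.
  apply: (@le_lt_trans _ _ (t * N)).
    rewrite /N [X in _ <= X]mulrDr mulr1 mulrDr addrC.
    have h1' : `|s1| * `|w| <= t * `|w| by rewrite ler_wpM2r.
    have h2' : `|s2| * `|v| <= t * `|v| by rewrite ler_wpM2r.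
    by move: (ltW t0); lra.
  by rewrite /t mulrAC mulfVK ?gt_eqF// ltr_pdivrMr// ltr_pMr// ltr1n.
clearbody t; have [s1 s2 h1 h2|s1 [s2 [h1 h2 E]]] := @second_difference f x v w t.
  have xy := near_x _ _ h2 h1.
  by have [[d1 _ d3 _] _] := rP _ xy; split; [exact: d1|exact: d3].
have [s3 s4 h3 h4|s3 [s4 [h3 h4 E']]] := @second_difference f x w v t.
  have := near_x _ _ h3 h4; rewrite addrCA => /rP[[_ d2 _ d4] _].
  by split; [exact: d2|exact: d4].
have xy := near_x _ _ h2 h1.
have [_ [d1 _]] := rP _ xy.
have := near_x _ _ h3 h4; rewrite addrCA => /rP[_ [_ d2]].
(* Both second differences are the same combination of four values of [f]; the factor t^2
   cancels. *)
have EE : 'D_w ('D_v f) (s2 *: w + (s1 *: v + x)) = 'D_v ('D_w f) (s4 *: v + (s3 *: w + x)).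
  apply: (mulfI (lt0r_neq0 t0)); apply: (mulfI (lt0r_neq0 t0)).
  apply: etrans (esym E) _; apply: etrans _ E'; rewrite (addrCA (t *: v)).
  by move: (f _) (f _) (f _) (f _) => a b c e'; ring.
exact: aux EE d1 d2.
Qed.

End directional_derivatives.

(** * Smooth functions and solutions of the Helmholtz equation *)

Section smooth_functions.
Context {R : realType} {d : nat}.
Implicit Types (f g u : 'rV[R]_d -> R) (A : set 'rV[R]_d) (s : seq 'I_d)
  (x y : 'rV[R]_d) (r : R).

Lemma smoothP A f : smooth A f <-> forall s x, A x ->
  {for x, continuous (pderivs s f)} /\
  forall i, derivable (pderivs s f) x (delta_mx 0 i).
Proof.
split=> [sf s x Ax|sf k s _].
  by split=> [|i]; [apply: (sf _ s (leqnn _)).1|apply: (sf (size s).+1 s _).2].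
by split=> [x Ax|_ i x Ax]; [exact: (sf s x Ax).1|exact: (sf s x Ax).2].
Qed.

Lemma sub_smooth A B f : A `<=` B -> smooth B f -> smooth A f.
Proof. by move=> AB /smoothP sf; apply/smoothP => s x /AB; exact: sf. Qed.

Lemma pderivs_rcons s i f : pderivs (rcons s i) f = pderivs s (pderiv i f).
Proof. by rewrite /pderivs foldr_rcons. Qed.

Lemma smooth_pderiv A f i : smooth A f -> smooth A (pderiv i f).
Proof.
by move=> /smoothP sf; apply/smoothP => s x; rewrite -pderivs_rcons; exact: sf.
Qed.

Lemma near_open A (P : 'rV[R]_d -> Prop) x : open A -> A x ->
  (forall y, A y -> P y) -> \forall y \near x, P y.
Proof.
by move=> oA Ax AP; apply: filterS AP _; exact: open_nbhs_nbhs.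
Qed.

Lemma pderiv_comm A f i j x : open A -> smooth A f -> A x ->
  pderiv i (pderiv j f) x = pderiv j (pderiv i f) x.
Proof.
move=> oA /smoothP sf Ax; apply: derive_comm.
- apply: (near_open oA Ax _) => y Ay; split.
  + exact: (sf [::] y Ay).2.
  + exact: (sf [::] y Ay).2.
  + exact: (sf [:: j] y Ay).2.
  + exact: (sf [:: i] y Ay).2.
- exact: (sf [:: i; j] x Ax).1.
- exact: (sf [:: j; i] x Ax).1.
Qed.

Lemma eq_pderivs A f g s x : open A -> (forall y, A y -> f y = g y) -> A x ->
  pderivs s f x = pderivs s g x.
Proof.
move=> oA fg; elim: s x => [x /fg//|i s ih x Ax] /=.
by apply: near_eq_derive; exact: (near_open oA Ax ih).
Qed.

Lemma eq_smooth A f g : open A -> (forall y, A y -> f y = g y) ->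
  smooth A f -> smooth A g.
Proof.
move=> oA fg /smoothP sf; apply/smoothP => s x Ax.
have n : \forall y \near x, pderivs s f y = pderivs s g y.
  by apply: (near_open oA Ax _) => y; exact: (eq_pderivs s oA fg).
split=> [|i]; last exact: near_eq_derivable n ((sf s x Ax).2 i).
exact: near_eq_continuous n (sf s x Ax).1.
Qed.

Lemma pderivs_sub A f g s x : open A -> smooth A f -> smooth A g -> A x ->
  pderivs s (f \- g) x = pderivs s f x - pderivs s g x.
Proof.
move=> oA /smoothP sf /smoothP sg; elim: s x => [//|i s ih x Ax] /=.
rewrite -[RHS](@deriveB _ _ _ (pderivs s f) (pderivs s g)).
- by apply: near_eq_derive; exact: (near_open oA Ax ih).
- exact: (sf s x Ax).2.
- exact: (sg s x Ax).2.
Qed.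

Lemma smooth_sub A f g : open A -> smooth A f -> smooth A g -> smooth A (f \- g).
Proof.
move=> oA Sf Sg; have /smoothP sf := Sf; have /smoothP sg := Sg.
apply/smoothP => s x Ax.
have n : \forall y \near x, (pderivs s f \- pderivs s g) y = pderivs s (f \- g) y.
  by apply: (near_open oA Ax _) => y Ay; rewrite (pderivs_sub s oA Sf Sg Ay).
split=> [|i].
  apply: near_eq_continuous n _.
  by apply: continuousB; [exact: (sf s x Ax).1|exact: (sg s x Ax).1].
apply: near_eq_derivable n _; apply: derivableB.
  exact: (sf s x Ax).2.
exact: (sg s x Ax).2.
Qed.

Lemma near_affine A (a x : 'rV[R]_d) r : open A -> A (a + r *: x) ->
  \forall y \near x, A (a + r *: y).
Proof.
move=> oA Ax.
by apply: (@continuous_affine R _ a r x); exact: open_nbhs_nbhs.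
Qed.

Lemma pderivs_affine A f (a : 'rV[R]_d) r s x : open A -> smooth A f -> A (a + r *: x) ->
  pderivs s (fun y => f (a + r *: y)) x = r ^+ size s * pderivs s f (a + r *: x).
Proof.
move=> oA /smoothP sf; elim: s x => [|i s ih] x Ax; first by rewrite mul1r.
have D := is_derive_affine ((sf s _ Ax).2 i).
have D' : is_derive x (delta_mx 0 i)
    (r ^+ size s \*: (fun y => pderivs s f (a + r *: y)))
    (r ^+ size s *: (r * pderivs (i :: s) f (a + r *: x))) by exact: is_deriveZ.
rewrite exprSr -mulrA -[RHS](@derive_val _ _ _ _ _ _ _ D').
apply: near_eq_derive; near=> y; apply: ih.
by near: y; exact: near_affine.
Unshelve. all: by end_near. Qed.

Lemma smooth_affine A f (a : 'rV[R]_d) r : open A -> smooth A f ->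
  smooth [set y | A (a + r *: y)] (fun y => f (a + r *: y)).
Proof.
move=> oA Sf; have /smoothP sf := Sf; apply/smoothP => s x /= Ax.
have n : \forall y \near x, r ^+ size s * pderivs s f (a + r *: y) =
    pderivs s (fun y => f (a + r *: y)) y.
  near=> y; apply/esym/(pderivs_affine _ oA Sf).
  by near: y; exact: near_affine.
split=> [|i].
  apply: near_eq_continuous n _; apply: continuousM; first exact: cst_continuous.
  apply: (@continuous_comp _ _ _ (fun y => a + r *: y)) (sf s _ Ax).1.
  exact: continuous_affine.
apply: near_eq_derivable n _; apply: derivableZ.
exact: (@ex_derive _ _ _ _ _ _ _ (is_derive_affine ((sf s _ Ax).2 i))).
Unshelve. all: by end_near. Qed.

Lemma laplacian_pderiv A f i x : open A -> smooth A f -> A x ->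
  laplacian (pderiv i f) x = pderiv i (laplacian f) x.
Proof.
move=> oA Sf Ax; have /smoothP sf := Sf.
have -> : laplacian f = \sum_j pderiv j (pderiv j f).
  by apply/funext => y; rewrite fct_sumE.
rewrite /laplacian [RHS]derive_sum; last by move=> j; exact: (sf [:: j; j] x Ax).2.
apply: eq_bigr => j _; rewrite -[RHS](pderiv_comm j i oA (smooth_pderiv j Sf) Ax).
by apply: near_eq_derive; apply: (near_open oA Ax) => y; exact: pderiv_comm oA Sf.
Qed.

Lemma continuous_coord (i : 'I_d) : continuous (fun x : 'rV[R]_d => x 0 i).
Proof. by move=> x; exact: coord_continuous. Qed.

(** The squared Euclidean norm: unlike the norm itself it is polynomial, hence suitable for second
    derivatives. *)
Definition sqnorm x : R := \sum_i x 0 i ^+ 2.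

Lemma continuous_sqnorm : continuous sqnorm.
Proof.
apply: continuous_big => [|i _ x]; first exact: add_continuous.
by apply: (@continuousM _ _ (fun x : 'rV[R]_d => x 0 i)); exact: continuous_coord.
Qed.

Lemma continuous_enorm : continuous (@enorm R d).
Proof.
move=> x; apply: continuous_comp; first exact: continuous_sqnorm.
exact: sqrt_continuous.
Qed.

Lemma open_eball r : open (@eball R d r).
Proof.
apply: (@open_comp _ _ (@enorm R d) [set y | y < r]); last exact: open_lt.
by move=> x _; exact: continuous_enorm.
Qed.

Lemma sub_eball r r' : r <= r' -> @eball R d r `<=` eball r'.
Proof. by move=> rr' x xr; exact: lt_le_trans xr rr'. Qed.

End smooth_functions.

(** * Solutions of -Delta u = u in a Euclidean ball centred at 0 *)

Section helmholtz.
Context {R : realType} {d : nat}.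
Implicit Types (f u v : 'rV[R]_d -> R) (x : 'rV[R]_d) (r : R).

(** Nothing is asked outside the ball; for [r <= 0] the ball is empty and every function
    qualifies. *)
Definition helmholtz r u :=
  smooth (eball r) u /\ forall x, eball r x -> - laplacian u x = u x.

Lemma sub_helmholtz r r' u : r <= r' -> helmholtz r' u -> helmholtz r u.
Proof.
move=> rr' [su hu]; have sub := @sub_eball R d _ _ rr'.
by split=> [|x /sub]; [exact: sub_smooth su|exact: hu].
Qed.

(** The equation has constant coefficients, so it can be differentiated. This gives the equation for
    d_i u in Bernstein's computation and lets the estimates be iterated. *)
Lemma helmholtz_pderiv r u i : helmholtz r u -> helmholtz r (pderiv i u).
Proof.
move=> [su hu]; split=> [|x xr]; first exact: smooth_pderiv.
rewrite (laplacian_pderiv _ (@open_eball _ _ r) su xr).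
have dL : derivable (laplacian u) x (delta_mx 0 i).
  apply: (@near_eq_derivable _ _ _ (- u)).
    apply: (near_open (@open_eball _ _ r) xr) => y yr /=.
    by rewrite -[(- u) y]/(- u y) -hu// opprK.
  by apply: derivableN; have /smoothP/(_ [::] x xr)[_] := su; exact.
rewrite -[LHS](deriveN dL).
by apply: near_eq_derive; exact: (near_open (@open_eball _ _ r) xr hu).
Qed.

Lemma helmholtz_sub r u v : helmholtz r u -> helmholtz r v -> helmholtz r (u \- v).
Proof.
move=> [su hu] [sv hv]; split=> [|x xr].
  by apply: smooth_sub => //; exact: open_eball.
rewrite -[RHS]/(u x - v x) -(hu _ xr) -(hv _ xr) -opprD; congr (- _).
rewrite /laplacian -sumrB; apply: eq_bigr => i _.
exact: (pderivs_sub [:: i; i] (@open_eball _ _ r) su sv xr).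
Qed.

Lemma helmholtz0 r : helmholtz r (fun=> 0 : R).
Proof.
split=> [|x _].
  move=> k s sk; have [c D] := @Ck0 R d k s sk.
  by split=> [x _|/D {}D i x _]; [exact: c|exact: D].
rewrite /laplacian big1 ?oppr0// => i _.
by have := congr1 (@^~ x) (@pderivs0 R d [:: i; i]).
Qed.

Lemma eq_helmholtz r u v : (forall x, eball r x -> u x = v x) ->
  helmholtz r u -> helmholtz r v.
Proof.
move=> uv [su hu]; split=> [|x xr].
  by apply: eq_smooth su => //; exact: open_eball.
apply: etrans (etrans _ (hu x xr)) (uv x xr); congr (- _).
apply: eq_bigr => i _.
exact/esym/(@eq_pderivs _ _ _ _ _ [:: i; i] _ (@open_eball _ _ r) uv).
Qed.

End helmholtz.

(** * Bernstein's interior gradient estimate *)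

Section second_order_derivatives.
Context {R : realType} {V : normedModType R}.
Implicit Types (f g : V -> R) (x e : V) (a b : R).

(** A relational form of the second derivative along [e], so that the sum and product rules assemble
    that of Bernstein's function from its factors. *)
Definition is_derive2 x e f f1 a :=
  (\forall y \near x, is_derive y e f (f1 y)) /\ is_derive x e f1 a.

Lemma is_derive2D x e f g f1 g1 a b :
  is_derive2 x e f f1 a -> is_derive2 x e g g1 b ->
  is_derive2 x e (fun y => f y + g y) (fun y => f1 y + g1 y) (a + b).
Proof.
move=> [nf df] [ng dg]; split; last exact: is_deriveD.
by apply: filterS2 nf ng => y; exact: is_deriveD.
Qed.

Lemma is_derive2M x e f g f1 g1 a b :
  is_derive2 x e f f1 a -> is_derive2 x e g g1 b ->
  is_derive2 x e (fun y => f y * g y) (fun y => f y * g1 y + g y * f1 y)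
    (f x * b + 2 * (f1 x * g1 x) + g x * a).
Proof.
move=> [nf df] [ng dg]; split.
  by apply: filterS2 nf ng => y; exact: is_deriveM.
have -> : f x * b + 2 * (f1 x * g1 x) + g x * a =
    (f x *: b + g1 x *: f1 x) + (g x *: a + f1 x *: g1 x).
  by rewrite /GRing.scale/=; ring.
apply: is_deriveD.
  by apply: is_deriveM => //; exact: nbhs_singleton nf.
by apply: is_deriveM => //; exact: nbhs_singleton ng.
Qed.

Lemma is_derive2Z x e (k : R) f f1 a : is_derive2 x e f f1 a ->
  is_derive2 x e (fun y => k * f y) (fun y => k * f1 y) (k * a).
Proof.
move=> [nf df]; split; last exact: is_deriveZ.
by apply: filterS nf => y; exact: is_deriveZ.
Qed.

Lemma is_derive2_cst x e (k : R) : is_derive2 x e (fun=> k) (fun=> 0) 0.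
Proof. by split; [near=> y|]; exact: is_derive_cst.
Unshelve. all: by end_near. Qed.

Lemma is_derive2_max x e f f1 a : is_derive2 x e f f1 a ->
  (\forall y \near x, f y <= f x) -> a <= 0.
Proof.
move=> [nf df] fx.
have n1 : {near x, f1 =1 'D_e f}.
  by apply: filterS nf => y [_ <-].
have [d2 <-] := near_eq_is_derive n1 df.
apply: second_derivative_test => //.
by apply: filterS nf => y [].
Qed.

End second_order_derivatives.

Section sqr_enorm.
Context {R : realType} {d : nat}.
Implicit Types (x : 'rV[R]_d) (r : R).

Lemma sqnorm_ge0 x : 0 <= sqnorm x.
Proof. by apply: sumr_ge0 => i _; exact: sqr_ge0. Qed.

Lemma sqr_enorm x : enorm x ^+ 2 = sqnorm x.
Proof. by rewrite sqr_sqrtr// sqnorm_ge0. Qed.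

Lemma eballE r x : 0 <= r -> eball r x <-> sqnorm x < r ^+ 2.
Proof.
by move=> r0; rewrite /eball/= -sqr_enorm ltr_pXn2r// nnegrE sqrtr_ge0.
Qed.

Lemma is_derive_coord x v i : is_derive x v (fun y => y 0 i) (v 0 i).
Proof.
suff c : (fun h => h^-1 *: (((fun y : 'rV[R]_d => y 0 i) \o shift x) (h *: v) - x 0 i))
    @ 0^' --> v 0 i.
  by apply: DeriveDef; [apply/cvg_ex; exists (v 0 i)|exact: cvg_lim c].
apply: cvg_near_cst; near=> h.
have h0 : h != 0 by near: h; exact: nbhs_dnbhs_neq.
by rewrite /= !mxE addrK scalerA mulVf// scale1r.
Unshelve. all: by end_near. Qed.

Lemma is_derive2_sqnorm x i :
  is_derive2 x (delta_mx 0 i) sqnorm (fun y => 2 * y 0 i) 2.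
Proof.
split.
  near=> y.
  have D : is_derive y (delta_mx 0 i) (\sum_j ((fun z : 'rV[R]_d => z 0 j) ^+ 2))
      (\sum_j ((2%:R * y 0 j ^+ 1) *: (delta_mx 0 i : 'rV[R]_d) 0 j)).
    by apply: is_derive_sum => j; apply: is_deriveX; exact: is_derive_coord.
  have -> : sqnorm = \sum_j ((fun z : 'rV[R]_d => z 0 j) ^+ 2).
    by apply/funext => z; rewrite fct_sumE; apply: eq_bigr => j _; rewrite exprfctE.
  suff -> : 2 * y 0 i = \sum_j ((2%:R * y 0 j ^+ 1) *: (delta_mx 0 i : 'rV[R]_d) 0 j) by [].
  rewrite (bigD1 i)//= big1 ?addr0 => [|j ji].
    by rewrite !mxE !eqxx [_ *: _]mulr1.
  by rewrite !mxE (negbTE ji) andbF scaler0.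
have := @is_deriveZ _ _ _ _ 2 x (delta_mx 0 i) _ (is_derive_coord x (delta_mx 0 i) i).
by rewrite !mxE !eqxx [_ *: _]mulr1.
Unshelve. all: by end_near. Qed.

Lemma norm_le_enorm x : `|x| <= enorm x.
Proof.
rewrite {1}/Num.norm/= mx_normrE; apply: bigmax_le => [|[i j] _]; first exact: sqrtr_ge0.
by rewrite /= ord1; exact: coord_le_enorm.
Qed.

Lemma compact_sqnorm r : compact [set x : 'rV[R]_d | sqnorm x <= r].
Proof.
apply: bounded_closed_compact.
  exists (Num.sqrt r); split; first exact: num_real.
  move=> M rM x /= xr; apply: le_trans (norm_le_enorm x) _.
  by apply: le_trans (ltW rM); exact: ler_wsqrtr.
apply: (@closed_comp _ _ sqnorm [set y | y <= r]); last exact: closed_le.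
by move=> x _; exact: continuous_sqnorm.
Qed.

End sqr_enorm.

Section interior_gradient_estimate.
Context {R : realType} {d : nat}.
Implicit Types (u v w : 'rV[R]_d -> R) (x : 'rV[R]_d) (r : R).

Lemma helmholtz_is_derive2 r u j x : helmholtz r u -> eball r x ->
  is_derive2 x (delta_mx 0 j) u (pderiv j u) (pderiv j (pderiv j u) x).
Proof.
move=> [/smoothP su _] xr; split.
  apply: (near_open (@open_eball _ _ r) xr) => y yr.
  by apply: derivableP; exact: (su [::] y yr).2.
by apply: derivableP; exact: (su [:: j] x xr).2.
Qed.

Lemma bernstein_constant_gt0 (rho : R) : 0 < rho ->
  0 < 12 * rho ^+ 2 + 2 * d%:R * rho ^+ 2 + rho ^+ 4.
Proof.
move=> rho0; have := exprn_gt0 2 rho0; have := exprn_gt0 4 rho0.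
move=> p4 p2; have : 0 <= d%:R * rho ^+ 2 by rewrite mulr_ge0// ltW.
by rewrite -[2 * d%:R * _]mulrA; lra.
Qed.

(* In the application p, q, a, b, c are u, v = d_i u, d_j d_j v, d_j d_j u, d_j u
   at x. The choice of lam makes the coefficient of q^2 nonnegative, since
   0 < eta <= rho^2, and gam dominates the term - 2 lam p^2. *)
Lemma bernstein_sum x (i : 'I_d) (a b c : 'I_d -> R) (rho M lam gam eta p q : R) :
  0 < rho -> 0 < M ->
  lam = 12 * rho ^+ 2 + 2 * d%:R * rho ^+ 2 + rho ^+ 4 ->
  gam = 2 * lam * M ^+ 2 ->
  eta = rho ^+ 2 - sqnorm x -> sqnorm x < rho ^+ 2 ->
  c i = q -> \sum_j a j = - q -> \sum_j b j = - p -> p * p <= M ^+ 2 ->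
  0 < \sum_j (q * q * (- 24 * x 0 j ^+ 2 - 4 * eta)
      + 2 * (eta * eta * q) * a j + 2 * lam * p * b j
      + 2 * lam * (c j ^+ 2) + 2 * gam).
Proof.
move=> rho0 M0 lamE gamE etaE xrho ci aE bE pM.
have lam0 : 0 < lam by rewrite lamE bernstein_constant_gt0.
have M2 : 0 < M ^+ 2 by rewrite exprn_gt0.
rewrite !big_split/= -!mulr_sumr aE bE.
have -> : \sum_j (- 24 * x 0 j ^+ 2 - 4 * eta) = - 24 * sqnorm x - 4 * d%:R * eta.
  rewrite big_split/= -mulr_sumr sumr_const card_ord -[in RHS]mulrA; congr (_ + _).
  by rewrite -mulr_natl; ring.
rewrite sumr_const card_ord.
(* Of the squared gradient only the [i]-th component is kept; times [lam] it absorbs the negative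
   terms in q^2. *)
have grad : q ^+ 2 <= \sum_j c j ^+ 2.
  by rewrite (bigD1 i)//= ci lerDl sumr_ge0// => j _; exact: sqr_ge0.
(* The index [i] forces d >= 1, so the terms 2 gam sum to at least 2 gam. *)
have d1 : 1 <= (d%:R : R).
  by rewrite ler1n; case: d i {a b c ci aE bE grad} => // -[].
have eta0 : 0 < eta by rewrite etaE subr_gt0.
have etarho : eta <= rho ^+ 2 by rewrite etaE gerDl oppr_le0 sqnorm_ge0.
have etaeta : eta * eta <= rho ^+ 4.
  by rewrite (_ : 4 = 2 + 2)%N// exprD ler_pM// ltW.
have coef : 0 <= 2 * lam - 24 * sqnorm x - 4 * d%:R * eta - 2 * (eta * eta).
  have : d%:R * eta <= d%:R * rho ^+ 2 by rewrite ler_wpM2l.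
  by have := ltW xrho; rewrite lamE -[2 * d%:R * _]mulrA -[4 * d%:R * _]mulrA; lra.
have P1 : 0 <= (2 * lam - 24 * sqnorm x - 4 * d%:R * eta - 2 * (eta * eta)) * q ^+ 2.
  by rewrite mulr_ge0// sqr_ge0.
have P2 : lam * q ^+ 2 <= lam * \sum_j c j ^+ 2 by rewrite ler_pM2l.
have P3 : lam * (p * p) <= lam * M ^+ 2 by rewrite ler_pM2l.
have P4 : 0 < lam * M ^+ 2 by rewrite mulr_gt0.
have P5 : 2 * gam <= 2 * (gam *+ d).
  by rewrite ler_pM2l// -[X in X <= _]mul1r -mulr_natl ler_pM2r// gamE !mulr_gt0.
apply: (@lt_le_trans _ _ (2 * lam * M ^+ 2)); first by rewrite -mulrA mulr_gt0.
move: P1 P2 P5; rewrite gamE; move: (\sum_j _) (_ *+ d) => S G; lra.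
Qed.

(** Over the closed ball of radius [rho], compact and inside the domain since rho < rho', the
    function [w] is maximal on the sphere only, where [eta] = 0 and the bound on [u] suffices. At
    [x], [eta] is at least rho^2 - r^2. *)
Lemma gradient_estimate_radius (rho rho' r M : R) u i :
  0 <= r < rho -> rho < rho' -> 0 < M -> helmholtz rho' u ->
  (forall x, eball rho' x -> `|u x| <= M) ->
  forall x, eball r x ->
  (rho ^+ 2 - r ^+ 2) ^+ 2 * pderiv i u x ^+ 2 <=
  (12 * rho ^+ 2 + 2 * d%:R * rho ^+ 2 + rho ^+ 4) * (1 + 2 * rho ^+ 2) * M ^+ 2.
Proof.
move=> /andP[r0 rrho] rhorho' M0 hu uM x xr.
have rho0 : 0 < rho by exact: le_lt_trans rrho.
have hv := helmholtz_pderiv i hu.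
pose v := pderiv i u.
pose lam := 12 * rho ^+ 2 + 2 * d%:R * rho ^+ 2 + rho ^+ 4.
have lam0 : 0 < lam by exact: bernstein_constant_gt0.
have [gam gam0 gamE] : exists2 gam, 0 < gam & gam = 2 * lam * M ^+ 2.
  by exists (2 * lam * M ^+ 2); rewrite // !mulr_gt0// exprn_gt0.
(* Written as a sum with a scalar multiple to match [is_derive2D] and [is_derive2Z]. *)
pose eta (y : 'rV[R]_d) : R := rho ^+ 2 + (-1) * sqnorm y.
pose w (y : 'rV[R]_d) : R := (eta y * eta y) * (v y * v y) +
  (lam * (u y * u y) + gam * sqnorm y).
pose K := [set y : 'rV[R]_d | sqnorm y <= rho ^+ 2].
have Krho' y : K y -> eball rho' y.
  move=> Ky; apply/eballE; first exact: ltW (lt_trans rho0 _).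
  by rewrite (le_lt_trans Ky)// ltr_pXn2r// nnegrE ltW// (lt_trans rho0).
have smooth_cont u' : helmholtz rho' u' -> forall y, K y -> {for y, continuous u'}.
  by move=> [/smoothP su' _] y /Krho' /(su' [::])[].
have c_eta : continuous eta.
  move=> y; apply: (@continuousD _ _ _ (fun=> rho ^+ 2) (fun y => -1 * sqnorm y)).
    exact: cst_continuous.
  apply: (@continuousM _ _ (fun=> -1) sqnorm); first exact: cst_continuous.
  exact: continuous_sqnorm.
have cw : {within K, continuous w}.
  apply: continuous_in_subspaceT => y /[1!inE] Ky.
  have cu := smooth_cont u hu y Ky; have cv := smooth_cont v hv y Ky.
  apply: (@continuousD _ _ _ (fun y => (eta y * eta y) * (v y * v y))).
    by apply: continuousM; apply: continuousM => //; exact: c_eta.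
  apply: (@continuousD _ _ _ (fun y => lam * (u y * u y))).
    by apply: continuousM; [exact: cst_continuous|exact: continuousM].
  by apply: continuousM; [exact: cst_continuous|exact: continuous_sqnorm].
have Kx : K x.
  by have /(eballE _ r0) xr2 := xr; rewrite /K/= ltW// (lt_trans xr2)// ltr_pXn2r// nnegrE ltW.
have [|z /[1!inE] Kz wz] := @compact_EVT_max _ _ w K _ (@compact_sqnorm _ _ _) cw.
  by exists x.
have uM2 y : K y -> u y * u y <= M ^+ 2.
  move=> /Krho'/uM uyM; rewrite -expr2 -(real_normK (num_real (u y))).
  by rewrite ler_pXn2r// nnegrE (ltW M0).
have wzM : w z <= lam * (1 + 2 * rho ^+ 2) * M ^+ 2.
  have [zrho|zrho] := ltP (sqnorm z) (rho ^+ 2); last first.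
    have qz : sqnorm z = rho ^+ 2 by apply/eqP; rewrite eq_le zrho andbT.
    rewrite /w /eta qz mulN1r subrr !mul0r add0r.
    have : lam * (u z * u z) <= lam * M ^+ 2 by rewrite ler_pM2l// uM2.
    by rewrite gamE; lra.
  (* At an interior maximum each pure second derivative of [w] is at most 0, while by
     [bernstein_sum] their total is positive. *)
  exfalso.
  have zr' := Krho' z Kz.
  (* The second derivative of [w] along the [j]-th axis, in the exact shape that the [is_derive2]
     rules produce. *)
  pose wz2 j := ((eta z * eta z) * (v z * pderiv j (pderiv j v) z +
         2 * (pderiv j v z * pderiv j v z) + v z * pderiv j (pderiv j v) z)
       + 2 * ((eta z * (0 + (-1) * (2 * z 0 j)) + eta z * (0 + (-1) * (2 * z 0 j))) *
              (v z * pderiv j v z + v z * pderiv j v z))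
       + (v z * v z) * (eta z * (0 + (-1) * 2) +
           2 * ((0 + (-1) * (2 * z 0 j)) * (0 + (-1) * (2 * z 0 j))) +
           eta z * (0 + (-1) * 2)))
    + (lam * (u z * pderiv j (pderiv j u) z + 2 * (pderiv j u z * pderiv j u z) +
        u z * pderiv j (pderiv j u) z) + gam * 2).
  have wz2_le0 j : wz2 j <= 0.
    have De : is_derive2 z (delta_mx 0 j) eta (fun y => 0 + (-1) * (2 * y 0 j)) (0 + (-1) * 2).
      by apply: is_derive2D; [exact: is_derive2_cst|apply: is_derive2Z; exact: is_derive2_sqnorm].
    have Du := helmholtz_is_derive2 j hu zr'.
    have Dv := helmholtz_is_derive2 j hv zr'.
    have Dw := is_derive2D (is_derive2M (is_derive2M De De) (is_derive2M Dv Dv))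
      (is_derive2D (is_derive2Z lam (is_derive2M Du Du))
        (is_derive2Z gam (is_derive2_sqnorm z j))).
    apply: (is_derive2_max Dw).
    have zb : eball rho z by apply/eballE => //; exact: ltW.
    apply: (near_open (@open_eball _ _ rho) zb) => y.
    by move=> /(eballE _ (ltW rho0)) /ltW yK; apply: wz; rewrite inE.
  have key j : v z * v z * (- 24 * z 0 j ^+ 2 - 4 * eta z)
      + 2 * (eta z * eta z * v z) * pderiv j (pderiv j v) z
      + 2 * lam * u z * pderiv j (pderiv j u) z
      + 2 * lam * (pderiv j u z ^+ 2) + 2 * gam <= wz2 j.
    rewrite -subr_ge0 /wz2; move: (pderiv j (pderiv j v) z) (pderiv j (pderiv j u) z).
    move: (pderiv j v z) (pderiv j u z) (eta z) (v z) (u z) (z 0 j) => a b c e f g p q.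
    (* completing the square in d_j v absorbs the cross term *)
    rewrite (_ : _ - _ = 2 * (c * a - 4 * g * e) ^+ 2); last by ring.
    by rewrite mulr_ge0// sqr_ge0.
  have etaE : eta z = rho ^+ 2 - sqnorm z by rewrite /eta mulN1r.
  have sum_v : \sum_j pderiv j (pderiv j v) z = - v z.
    by apply: oppr_inj; rewrite opprK; exact: hv.2.
  have sum_u : \sum_j pderiv j (pderiv j u) z = - u z.
    by apply: oppr_inj; rewrite opprK; exact: hu.2.
  have := @bernstein_sum z i (fun j => pderiv j (pderiv j v) z)
    (fun j => pderiv j (pderiv j u) z) (fun j => pderiv j u z)
    rho M lam gam (eta z) (u z) (v z) rho0 M0 erefl gamE etaE zrho erefl sum_v sum_u
    (uM2 z Kz).
  move=> pos.
  have := lt_le_trans pos (sumr_le0 _ (fun j _ => le_trans (key j) (wz2_le0 j))).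
  by rewrite ltxx.
have wxM := le_trans (wz x (mem_set Kx)) wzM.
rewrite -/lam; apply: le_trans wxM; rewrite /w -/v.
apply: (@le_trans _ _ ((eta x * eta x) * (v x * v x))); last first.
  rewrite lerDl addr_ge0//; first by rewrite -expr2 mulr_ge0 ?sqr_ge0// (ltW lam0).
  by rewrite mulr_ge0 ?sqnorm_ge0// (ltW gam0).
rewrite -!expr2 ler_wpM2r ?sqr_ge0//.
have q : sqnorm x <= r ^+ 2 by have /(eballE _ r0)/ltW := xr.
have rr : r ^+ 2 < rho ^+ 2 by rewrite ltr_pXn2r// nnegrE (ltW rho0).
have h1 : 0 <= rho ^+ 2 - r ^+ 2 by lra.
have h2 : rho ^+ 2 - r ^+ 2 <= eta x by rewrite /eta; lra.
by rewrite ler_pXn2r// nnegrE (le_trans h1 h2).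
Qed.

(** Bernstein's estimate at the radius halfway between [r] and [rho]. The constant depends on the
    radii and the dimension only, not on [u], as the passage to limits requires. *)
Lemma interior_gradient_estimate (r rho : R) : 0 <= r < rho ->
  exists2 C : R, 0 < C & forall u i M, 0 < M -> helmholtz rho u ->
    (forall x, eball rho x -> `|u x| <= M) ->
    forall x, eball r x -> `|pderiv i u x| <= C * M.
Proof.
move=> /andP[r0 rrho]; pose r1 := (r + rho) / 2.
have rr1 : r < r1 by rewrite /r1; lra.
have r1rho : r1 < rho by rewrite /r1; lra.
pose K := (12 * r1 ^+ 2 + 2 * d%:R * r1 ^+ 2 + r1 ^+ 4) * (1 + 2 * r1 ^+ 2).
have r10 : 0 < r1 by exact: le_lt_trans rr1.
have K0 : 0 < K.
  rewrite mulr_gt0//; last by rewrite ltr_wpDr// mulr_ge0// exprn_ge0// ltW.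
  exact: bernstein_constant_gt0.
have D0 : 0 < r1 ^+ 2 - r ^+ 2.
  by rewrite subr_gt0 ltr_pXn2r// nnegrE// ltW.
have [c c0 cK] : exists2 c, 0 < c & c ^+ 2 = K.
  by exists (Num.sqrt K); [rewrite sqrtr_gt0|exact: sqr_sqrtr (ltW K0)].
exists (c / (r1 ^+ 2 - r ^+ 2)); first by rewrite divr_gt0.
move=> u i M M0 hu uM x xr.
have := @gradient_estimate_radius r1 rho r M u i _ r1rho M0 hu uM x xr.
rewrite r0 rr1 => /(_ isT) H.
rewrite mulrAC ler_pdivlMr// mulrC -ler_sqr ?nnegrE; last 2 first.
- by rewrite mulr_ge0// ltW.
- by rewrite mulr_ge0// ltW.
rewrite exprMn real_normK ?num_real// [(c * M) ^+ 2]exprMn cK.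
exact: H.
Qed.

End interior_gradient_estimate.

(** * Uniform limits of solutions *)

Section uniform_limits.
Context {R : realType} {d : nat}.
Implicit Types (f u : 'rV[R]_d -> R) (x : 'rV[R]_d) (r rho : R).

(** The uniform closure of the solutions, with one approximant for each accuracy, so that no
    sequence has to be chosen. *)
Definition helmholtz_limit rho f := forall e : R, 0 < e ->
  exists2 u, helmholtz rho u & forall x, eball rho x -> `|f x - u x| <= e.

Lemma sub_helmholtz_limit r rho f : r <= rho ->
  helmholtz_limit rho f -> helmholtz_limit r f.
Proof.
move=> rrho lf e /lf[u hu fu]; exists u; first exact: sub_helmholtz hu.
by move=> x /(sub_eball rrho); exact: fu.
Qed.

Lemma helmholtz_limit_continuous rho f x : helmholtz_limit rho f ->
  eball rho x -> {for x, continuous f}.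
Proof.
move=> lf xrho; apply: continuous_at_dist => e e0.
have e3 : 0 < e / 3 by rewrite divr_gt0.
have [u [/smoothP su _] fu] := lf _ e3.
have cu : {for x, continuous u} by exact: (su [::] x xrho).1.
have n1 : \forall y \near x, `|u x - u y| <= e / 3 by exact: cvgr_dist_le cu _ e3.
have n2 : \forall y \near x, eball rho y.
  exact: (near_open (@open_eball _ _ rho) xrho).
near=> y.
have h1 : `|u x - u y| <= e / 3 by near: y.
have /fu h2 : eball rho y by near: y.
have h3 := fu _ xrho.
rewrite (_ : f x - f y = (f x - u x) + (u x - u y) - (f y - u y)); last by ring.
rewrite (le_trans (ler_normB _ _))//.
have := ler_normD (f x - u x) (u x - u y); lra.
Unshelve. all: by end_near. Qed.

(** With solutions u' arbitrarily close to [f], the gradient estimate for u - u' bounds the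
    difference quotients of f - u by C M, uniformly in the step. The quotients of [f] are therefore
    Cauchy, and the bound survives in the limit. *)
Lemma helmholtz_limit_pderiv r rho : 0 <= r < rho ->
  exists2 C : R, 0 < C & forall f i, helmholtz_limit rho f ->
    forall x, eball r x -> derivable f x (delta_mx 0 i) /\
      forall u M, 0 < M -> helmholtz rho u ->
        (forall y, eball rho y -> `|f y - u y| <= M) ->
        `|pderiv i f x - pderiv i u x| <= C * M.
Proof.
move=> /andP[r0 rrho]; pose r1 := (r + rho) / 2.
have rr1 : r < r1 by rewrite /r1; lra.
have r1rho : r1 < rho by rewrite /r1; lra.
have r10 : 0 <= r1 by lra.
have [|C C0 HC] := @interior_gradient_estimate R d r1 rho; first by rewrite r10.
exists C => // f i lf x xr.
pose v : 'rV[R]_d := delta_mx 0 i.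
pose q g (t : R) : R := t^-1 *: ((g \o shift x) (t *: v) - g x).
have xr1 : eball r1 x by exact: sub_eball (ltW rr1) _ xr.
have n1 : \forall y \near x, eball r1 y.
  exact: (near_open (@open_eball _ _ r1) xr1).
have [e e0 eP] := near_line v n1.
have quot u M t : 0 < M -> helmholtz rho u ->
    (forall y, eball rho y -> `|f y - u y| <= M) -> `|t| <= e -> t != 0 ->
    `|q f t - q u t| <= C * M.
  move=> M0 hu fu te t0.
  have sub1 (y : 'rV[R]_d) : eball r1 y -> eball rho y by exact: sub_eball (ltW r1rho) y.
  rewrite /q -scalerBr normrZ normfV mulrC ler_pdivrMr ?normr_gt0//.
  apply/ler_addgt0Pl => b b0.
  have K0 : 0 < 2 + `|t| * C by rewrite ltr_wpDr// mulr_ge0// ltW.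
  (* The total error is 2 b' + |t| C b' = b; [b'] may depend on [t], which is fixed at this
     point. *)
  pose b' := b / (2 + `|t| * C).
  have b'0 : 0 < b' by rewrite divr_gt0.
  have [u' hu' fu'] := lf _ b'0.
  have huu' := helmholtz_sub hu hu'.
  have uu' y : eball rho y -> `|(u \- u') y| <= M + b'.
    move=> yrho; rewrite /= (_ : u y - u' y = (f y - u' y) - (f y - u y)); last by ring.
    rewrite (le_trans (ler_normB _ _))// addrC lerD//; [exact: fu|exact: fu'].
  have Mb0 : 0 < M + b' by rewrite addr_gt0.
  have [|s st E] := @MVT_line _ _ (u \- u') x v t.
    move=> s st; have sr1 := eP _ (le_trans st te).
    by have [/smoothP/(_ [::] _ (sub1 _ sr1))[_ D] _] := huu'; exact: D.
  have sr1 := eP _ (le_trans st te).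
  have := HC _ i _ Mb0 huu' uu' _ sr1; rewrite -/v => D.
  have xt := eP _ te.
  have h1 := fu' _ (sub1 _ xt); have h2 := fu' _ (sub1 _ xr1).
  have h3 : `|(u \- u') (t *: v + x) - (u \- u') x| <= `|t| * (C * (M + b')).
    by rewrite E normrM ler_wpM2l.
  move: h3 => /= h3.
  set A := f (t *: v + x) in h1 *; set B := u (t *: v + x) in h3 *.
  set A' := u' (t *: v + x) in h1 h3.
  rewrite (_ : _ - _ = (A - A') - (f x - u' x) - (B - A' - (u x - u' x))); last first.
    by rewrite /=; ring.
  rewrite (le_trans (ler_normB _ _))//.
  have h4 := ler_normB (A - A') (f x - u' x).
  have -> : b = 2 * b' + `|t| * (C * b') by rewrite /b'; field; exact: lt0r_neq0.
  by move: h3; rewrite mulrDr mulrDr [C * M * _]mulrC; lra.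
have quot_near u M : 0 < M -> helmholtz rho u ->
    (forall y, eball rho y -> `|f y - u y| <= M) ->
    \forall t \near 0^', `|q f t - q u t| <= C * M.
  move=> M0 hu fu; near=> t; apply: quot M0 hu fu _ _.
    near: t; apply: dnbhs0_le => //.
  by near: t; exact: nbhs_dnbhs_neq.
have xrho : eball rho x by exact: sub_eball (ltW r1rho) _ xr1.
have du u : helmholtz rho u -> q u @ 0^' --> pderiv i u x.
  by move=> [/smoothP/(_ [::] x xrho)[_ D] _]; exact: D.
have df : derivable f x v.
  (* The quotients of [f] end up within [b] of d_i u(x): one half comes from the convergence for
     [u], the other from C M = b / 2. *)
  apply: cauchy_cvg; apply: cauchy_exP => b b0.
  have M0 : 0 < b / 2 / C by rewrite !divr_gt0.
  have [u hu fu] := lf _ M0.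
  exists (pderiv i u x).
  have b2 : 0 < b / 2 by rewrite divr_gt0.
  have n2 : \forall t \near 0^', `|pderiv i u x - q u t| < b / 2.
    exact: cvgr_dist_lt (du u hu) _ b2.
  have n3 := quot_near _ _ M0 hu fu.
  rewrite mulrC divfK ?gt_eqF// in n3.
  apply: filterS2 n2 n3 => t h2 h3.
  rewrite -ball_normE/= -/(q f t).
  rewrite (_ : _ - _ = (pderiv i u x - q u t) - (q f t - q u t)); last by ring.
  by rewrite (le_lt_trans (ler_normB _ _))//; lra.
split=> // u M M0 hu fu.
have c : `|q f t - q u t| @[t --> 0^'] --> `|pderiv i f x - pderiv i u x|.
  by apply: cvg_norm; apply: cvgB; [exact: df|exact: du].
rewrite -(cvg_lim _ c)//; apply: limr_le; first by apply/cvg_ex; eexists; exact: c.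
exact: quot_near.
Unshelve. all: by end_near. Qed.

(** Each derivative costs a slightly smaller ball; the radius halfway to [rho] always leaves room
    for one more, which is why [r] varies in the induction. *)
Lemma helmholtz_limit_pderivs r rho s f : 0 <= r < rho ->
  helmholtz_limit rho f -> helmholtz_limit r (pderivs s f).
Proof.
move=> + lf; elim: s r => [|i s ih] r /andP[r0 rrho].
  exact: sub_helmholtz_limit (ltW rrho) lf.
pose r1 := (r + rho) / 2.
have rr1 : r < r1 by rewrite /r1; lra.
have r1rho : r1 < rho by rewrite /r1; lra.
have r10 : 0 <= r1 by lra.
have ls : helmholtz_limit r1 (pderivs s f) by apply: ih; rewrite r10.
have [|C C0 HC] := @helmholtz_limit_pderiv r r1; first by rewrite r0.
move=> e e0; have eC : 0 < e / C by rewrite divr_gt0.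
have [u hu fu] := ls _ eC.
exists (pderiv i u); first exact: helmholtz_pderiv (sub_helmholtz (ltW rr1) hu).
move=> x xr; have [_ /(_ u _ eC hu fu)] := HC _ i ls x xr.
by rewrite mulrC divfK// gt_eqF.
Qed.

Lemma helmholtz_limit_helmholtz rho f : helmholtz_limit rho f -> helmholtz rho f.
Proof.
move=> lf.
(* Two nested radii, one for each of the two derivatives in the Laplacian. *)
have between x : eball rho x -> exists r1 r2, [/\ 0 <= r1 < r2, 0 <= r2 < rho & eball r1 x].
  move=> xrho; have x0 : 0 <= enorm x by exact: sqrtr_ge0.
  have xr : enorm x < rho by exact: xrho.
  exists ((2 * enorm x + rho) / 3), ((enorm x + 2 * rho) / 3).
  by split; [lra|lra|rewrite /eball/=; lra].
split.
  apply/smoothP => s x xrho.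
  have [r1 [r2 [r12 r2rho xr1]]] := between x xrho.
  have ls := helmholtz_limit_pderivs s r2rho lf.
  have xr2 : eball r2 x by case/andP: r12 => _ /ltW/sub_eball; exact.
  split=> [|i]; first exact: helmholtz_limit_continuous ls xr2.
  have [C _ /(_ _ i ls x xr1)[]//] := helmholtz_limit_pderiv r12.
move=> x xrho; have [r1 [r2 [r12 r2rho xr1]]] := between x xrho.
have [C1 C10 HC1] := helmholtz_limit_pderiv r2rho.
have [C2 C20 HC2] := helmholtz_limit_pderiv r12.
apply/eqP; rewrite -subr_eq0 -normr_eq0 eq_le normr_ge0 andbT.
apply/ler_addgt0Pl => e e0; rewrite addr0.
(* For M = e / K, the error d C2 C1 M on the Laplacian and the error M on [f] add up to [e]. *)
pose K := 1 + d%:R * (C2 * C1).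
have K0 : 0 < K by rewrite ltr_pwDl// mulr_ge0// mulr_ge0// ltW.
pose M := e / K.
have M0 : 0 < M by rewrite divr_gt0.
have [u hu fu] := lf _ M0.
have CM0 : 0 < C1 * M by rewrite mulr_gt0.
have D2 i : `|pderiv i (pderiv i f) x - pderiv i (pderiv i u) x| <= C2 * (C1 * M).
  have l1 : helmholtz_limit r2 (pderiv i f).
    exact: (helmholtz_limit_pderivs [:: i] r2rho lf).
  apply: (HC2 _ i l1 x xr1).2 => //.
    by apply: helmholtz_pderiv; apply: sub_helmholtz hu; case/andP: r2rho => _ /ltW.
  by move=> y yr2; exact: (HC1 _ i lf y yr2).2.
have DL : `|laplacian f x - laplacian u x| <= d%:R * (C2 * (C1 * M)).
  rewrite /laplacian -sumrB (le_trans (ler_norm_sum _ _ _))//.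
  rewrite (le_trans (ler_sum _ (fun i _ => D2 i)))//.
  by rewrite sumr_const card_ord mulr_natl.
have ux := hu.2 x xrho; have fux := fu x xrho.
have E : - laplacian f x - f x = - (laplacian f x - laplacian u x) - (f x - u x).
  by move: ux; move: (laplacian f x) (laplacian u x) (f x) (u x) => a b c e'; lra.
rewrite E (le_trans (ler_normB _ _))// normrN.
have -> : e = d%:R * (C2 * (C1 * M)) + M by rewrite /M /K; field; exact: lt0r_neq0.
by rewrite lerD.
Qed.

End uniform_limits.

(** * Integrals of non-measurable functions *)

Section lower_integral.
Local Open Scope ereal_scope.
Context d (T : measurableType d) (R : realType) (mu : {measure set T -> \bar R}).
Implicit Types f g : T -> \bar R.
Import HBNNSimple.

(** The integral of a nonnegative function is a supremum over the simple functions below it; the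
    section draws from this what survives for arbitrary functions. *)
Lemma sintegral_le_integral f (h : {nnsfun T >-> R}) :
  (forall x, (h x)%:E <= f x) -> sintegral mu h <= \int[mu]_x f x.
Proof.
move=> hf; rewrite ge0_integralTE.
  by apply: ereal_sup_ubound; exists h.
by move=> x; apply: le_trans (hf x); rewrite lee_fin; exact: fun_ge0.
Qed.

Lemma integral_le_sintegral f (z : \bar R) : (forall x, 0 <= f x) ->
  (forall h : {nnsfun T >-> R}, (forall x, (h x)%:E <= f x) -> sintegral mu h <= z) ->
  \int[mu]_x f x <= z.
Proof.
move=> f0 hz; rewrite ge0_integralTE//.
by apply: ge_ereal_sup => _ [h hf <-]; exact: hz.
Qed.

Lemma le_integral_nonmeasurable f g : (forall x, 0 <= f x) ->
  (forall x, f x <= g x) -> \int[mu]_x f x <= \int[mu]_x g x.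
Proof.
move=> f0 fg; apply: integral_le_sintegral => // h hf.
by apply: sintegral_le_integral => x; exact: le_trans (fg x).
Qed.

(** A simple function below [f] plus one below [g] is a simple function below f + g. *)
Lemma integral_superadditive f g : (forall x, 0 <= f x) -> (forall x, 0 <= g x) ->
  \int[mu]_x f x + \int[mu]_x g x <= \int[mu]_x (f x + g x).
Proof.
move=> f0 g0; set Z := \int[mu]_x (f x + g x).
have hZ (h1 h2 : {nnsfun T >-> R}) : (forall x, (h1 x)%:E <= f x) ->
    (forall x, (h2 x)%:E <= g x) -> sintegral mu h1 + sintegral mu h2 <= Z.
  move=> h1f h2g; rewrite -sintegralD//.
  apply: (sintegral_le_integral (h := add_nnsfun h1 h2)) => x /=.
  by rewrite EFinD leeD.
(* Once [Z] is finite all the terms are, and the two suprema can be taken one after the other by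
   subtraction. *)
have [Zoo|Zoo] := eqVneq Z +oo; first by rewrite Zoo leey.
have Z0 : 0 <= Z by apply: integral_ge0 => x _; exact: adde_ge0.
have Zfin : Z \is a fin_num by rewrite ge0_fin_numE// lt_neqAle Zoo leey.
have fin (h : {nnsfun T >-> R}) : sintegral mu h <= Z -> sintegral mu h \is a fin_num.
  move=> hle; rewrite ge0_fin_numE ?sintegral_ge0//.
  by rewrite (le_lt_trans hle)// ltey_eq Zfin.
have fZ : \int[mu]_x f x <= Z.
  by apply: le_integral_nonmeasurable => // x; exact: leeDl.
have ffin : \int[mu]_x f x \is a fin_num.
  by rewrite ge0_fin_numE ?integral_ge0// (le_lt_trans fZ)// ltey_eq Zfin.
rewrite -leeBrDl//; apply: integral_le_sintegral => // h2 h2g.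
have s2 : sintegral mu h2 <= Z.
  by apply: sintegral_le_integral => x; rewrite (le_trans (h2g x))// leeDr.
rewrite leeBrDl// -leeBrDr ?fin//; apply: integral_le_sintegral => // h1 h1f.
by rewrite leeBrDr ?fin// hZ.
Qed.

Lemma integral_scale_nonmeasurable f (k : R) : (0 <= k)%R -> (forall x, 0 <= f x) ->
  k%:E * \int[mu]_x f x <= \int[mu]_x (k%:E * f x).
Proof.
rewrite le_eqVlt => /predU1P[<- f0|k0 f0].
  by rewrite mul0e integral_ge0// => x _; rewrite mul0e.
rewrite -lee_pdivlMl//; apply: integral_le_sintegral => // h hf.
rewrite lee_pdivlMl// -sintegralrM.
apply: (sintegral_le_integral (h := scale_nnsfun h (ltW k0))) => x /=.
by rewrite EFinM lee_pmul2l.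
Qed.

Lemma integral_superadditive_sum (I : Type) (s : seq I) (f : I -> T -> \bar R) :
  (forall i x, 0 <= f i x) ->
  \sum_(i <- s) \int[mu]_x f i x <= \int[mu]_x (\sum_(i <- s) f i x).
Proof.
move=> f0; elim: s => [|i s ih].
  by rewrite big_nil integral_ge0// => x _; rewrite big_nil.
rewrite big_cons; apply: le_trans (leeD2l _ ih) _.
apply: le_trans (integral_superadditive _ _) _ => //.
  by move=> x; exact: sume_ge0.
by apply: le_integral_nonmeasurable => x; rewrite ?big_cons// adde_ge0// sume_ge0.
Qed.

End lower_integral.

(** * Averages of Dirac masses *)

Section average_of_diracs.
Local Open Scope ereal_scope.
Context d d' (X : measurableType d) (Y : measurableType d') (R : realType).
Variables (mu : {measure set X -> \bar R}) (c : R) (U : set X) (T : X -> Y).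
Hypothesis c0 : (0 <= c)%R.
Import HBNNSimple.

Let nu : set Y -> \bar R := fun B => c%:E * \int[mu]_(x in U) \d_(T x) B.

Let nu_ge0 B : 0 <= nu B.
Proof. by rewrite mule_ge0// integral_ge0. Qed.

Let nu0 : nu set0 = 0.
Proof. by rewrite /nu integral0_eq ?mule0// => x _; rewrite dirac0. Qed.

Let sintegral_nu_ge0 (h : {nnsfun Y >-> R}) : 0 <= sintegral nu h.
Proof.
rewrite sintegralET; apply: fsume_ge0 => r _.
have [hr|hr] := leP 0%R r; first by rewrite mule_ge0.
rewrite preimage10 ?nu0 ?mule0// => -[y _ hy].
by move: hr; rewrite -hy ltNge fun_ge0.
Qed.

(** Exchanging the finite sum over the values of [h] with the integral, in the superadditive
    direction, leaves the integral over [U] of h(T x), which is at most the indicator of [B]. *)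
Let sintegral_nu_le (h : {nnsfun Y >-> R}) (B : set X) : measurable B ->
  (forall x, (h (T x) <= 1)%R) -> (forall x, U x -> ~ B x -> h (T x) = 0%R) ->
  sintegral nu h <= c%:E * mu B.
Proof.
move=> mB h1 hB.
pose D r x := ((fun x => \d_(T x) (h @^-1` [set r])) \_ U) x : \bar R.
have D0 r x : 0 <= D r x by rewrite /D patchE; case: ifP.
have -> : sintegral nu h = \sum_(r <- fset_set (range h)) r%:E * nu (h @^-1` [set r]).
  transitivity (\sum_(r \in range h) r%:E * nu (h @^-1` [set r])).
    rewrite (fsbig_widen (range h) setT)//= => r [_ Nr] /=.
    by rewrite preimage10// nu0 mule0.
  by rewrite fsbig_finite.
have rge0 r : r \in fset_set (range h) -> (0 <= r)%R.
  by rewrite in_fset_set// inE => -[y _ <-]; exact: fun_ge0.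
have -> : \sum_(r <- fset_set (range h)) r%:E * nu (h @^-1` [set r]) =
    c%:E * \sum_(r <- fset_set (range h)) r%:E * \int[mu]_x D r x.
  rewrite big_seq [in RHS]big_seq ge0_sume_distrr.
    by apply: eq_bigr => r _; rewrite muleCA /nu integral_mkcond.
  by move=> r /rge0 r0; rewrite mule_ge0// integral_ge0.
rewrite lee_wpmul2l ?lee_fin//.
(* The maximum makes every term nonnegative, as superadditivity requires; on the range of [h] it is
   just r. *)
pose D' r x := (Num.max r 0)%:E * D r x.
have D'0 r x : 0 <= D' r x by rewrite mule_ge0// lee_fin le_max lexx orbT.
apply: (@le_trans _ _ (\sum_(r <- fset_set (range h)) \int[mu]_x D' r x)).
  rewrite big_seq [leRHS]big_seq; apply: lee_sum => r /rge0 r0.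
  rewrite /D' max_l//; exact: integral_scale_nonmeasurable.
apply: le_trans (integral_superadditive_sum _ _ _) _ => //.
rewrite -(setIT B) -integral_indic//; apply: le_integral_nonmeasurable.
  by move=> x; exact: sume_ge0.
move=> x; have [Ux|NUx] := pselect (U x); last first.
  rewrite big1 ?lee_fin// => r _.
  by rewrite /D' /D patchE memNset// mule0.
have -> : \sum_(r <- fset_set (range h)) D' r x = (h (T x))%:E.
  rewrite (bigD1_seq (h (T x))) ?fset_uniq//=; last first.
    by rewrite in_fset_set// inE; exists (T x).
  rewrite big1 ?adde0.
    rewrite /D' /D patchE mem_set// diracE mem_set// mule1 max_l//.
  move=> r rh; rewrite /D' /D patchE mem_set// diracE memNset ?mule0//=.
  by move=> E; move: rh; rewrite E eqxx.
have [Bx|NBx] := pselect (B x); first by rewrite indicE mem_set// lee_fin h1.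
by rewrite indicE memNset// (hB x Ux NBx).
Qed.

(* T is not assumed to be measurable: the inner integral is only a lower integral,
   which is superadditive, and this is the direction that is needed. *)
Lemma integral_average_dirac (F : Y -> R) (B : set X) : measurable B ->
  (forall y, (0 <= F y <= 1)%R) -> (forall x, U x -> ~ B x -> F (T x) = 0%R) ->
  0 <= \int[fun B => c%:E * \int[mu]_(x in U) \d_(T x) B]_y (F y)%:E <= c%:E * mu B.
Proof.
(* [nu] is not known to be a measure, so the integral is unfolded into the suprema for the positive
   and negative parts of [F]. *)
move=> mB F01 FB; rewrite -/nu /integral patch_setT.
have F0 y : (0 <= F y)%R by case/andP: (F01 y).
have F1 y : (F y <= 1)%R by case/andP: (F01 y).
set P := ereal_sup _; set N := ereal_sup _.
have -> : N = 0.
  apply/eqP; rewrite eq_le; apply/andP; split.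
    apply: ge_ereal_sup => _ [h hF <-].
    rewrite (_ : sintegral nu h = 0)//.
    have h0 y : h y = 0%R.
      apply/eqP; rewrite eq_le fun_ge0 andbT -lee_fin (le_trans (hF y))//.
      by rewrite (@ge0_funenegE _ _ setT) ?inE// => z _; rewrite lee_fin.
    rewrite sintegralET fsbig1// => r _.
    have [->|r0] := eqVneq r 0%R; first by rewrite mul0e.
    by rewrite preimage10 ?nu0 ?mule0// => -[y _]; rewrite h0 => /esym/eqP; rewrite (negbTE r0).
  apply: le_trans (sintegral_nu_ge0 nnsfun0) _; apply: ereal_sup_ubound.
  by exists nnsfun0 => // y /=; exact: funeneg_ge0.
rewrite sube0; apply/andP; split.
  apply: le_trans (sintegral_nu_ge0 nnsfun0) _; apply: ereal_sup_ubound.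
  by exists nnsfun0 => // y /=; exact: funepos_ge0.
apply: ge_ereal_sup => _ [h hF <-].
have hF' y : (h y <= F y)%R.
  rewrite -lee_fin (le_trans (hF y))// (@ge0_funeposE _ _ setT) ?inE// => z _.
  by rewrite lee_fin.
apply: sintegral_nu_le => // [x|x Ux NBx]; first exact: le_trans (hF' _) (F1 _).
by apply/eqP; rewrite eq_le fun_ge0 andbT -(FB x Ux NBx) hF'.
Qed.

End average_of_diracs.

(** * Functionals on H^k that vanish on FP *)

Section distance_to_set.
Context {R : realType} {T : metricType R}.
Implicit Types (A B : set T) (x y : T).

(** [inf] is 0 on the empty set, whence the nonemptiness assumptions below. *)
Definition setdist A x : R := inf [set mdist x y | y in A].

Let has_lbound_mdist A x : has_lbound [set mdist x y | y in A].
Proof. by exists 0 => _ [y _ <-]; exact: mdist_ge0. Qed.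

Lemma setdist_le A x y : A y -> setdist A x <= mdist x y.
Proof. by move=> Ay; apply: ge_inf => //; exists y. Qed.

Lemma setdist_ge0 A x : A !=set0 -> 0 <= setdist A x.
Proof.
move=> [a Aa]; apply: lb_le_inf; first by exists (mdist x a), a.
by move=> _ [y _ <-]; exact: mdist_ge0.
Qed.

Lemma setdist0 A x : A x -> setdist A x = 0.
Proof.
move=> Ax; apply/eqP; rewrite eq_le setdist_ge0 ?andbT; last by exists x.
by rewrite -(mdistxx x) setdist_le.
Qed.

Lemma setdist_lt A x e : A !=set0 -> setdist A x < e -> exists2 y, A y & mdist x y < e.
Proof.
move=> [a Aa] /inf_lt[|_ [y Ay <-] xye]; last by exists y.
by exists (mdist x a), a.
Qed.

Lemma le_setdist A B x : A !=set0 -> A `<=` B -> setdist B x <= setdist A x.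
Proof.
move=> [a Aa] AB; apply: lb_le_inf; first by exists (mdist x a), a.
by move=> _ [y /AB By <-]; exact: setdist_le.
Qed.

Lemma setdist_triangle A x y : A !=set0 -> setdist A x <= mdist x y + setdist A y.
Proof.
move=> [a Aa]; rewrite -lerBlDl; apply: lb_le_inf; first by exists (mdist y a), a.
move=> _ [z Az <-]; rewrite lerBlDl (le_trans (setdist_le x Az))//.
exact: metric_triangle.
Qed.

Lemma continuous_setdist A : A !=set0 -> continuous (setdist A).
Proof.
move=> A0 x; apply/cvgrPdist_lt => e e0; near=> y.
have : ball x e y by near: y; exact: nbhsx_ballx.
rewrite ballEmdist /= => xye; apply: le_lt_trans xye.
rewrite ler_distl; have h1 := setdist_triangle x y A0.
have := setdist_triangle y x A0; rewrite (metric_sym y x); lra.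
Unshelve. all: by end_near. Qed.

End distance_to_set.

(** * Truncated distances to the solutions in growing balls *)

Section Hk_functionals.
Context {R : realType} {d k : nat}.
Implicit Types f g : Hk R d k.

Lemma continuous_measurable_Hk (F : Hk R d k -> R) :
  continuous F -> measurable_fun setT F.
Proof.
move=> cF; apply: (measurability _ (measurable_realfun.RGenOpens.measurableE R)).
move=> _ [_ [a [b ->]] <-]; rewrite setTI; apply: sub_sigma_algebra.
by apply: open_comp; [move=> x _; exact: cF|exact: interval_open].
Qed.

Definition helmholtz_ball (m : nat) : set (Hk R d k) := [set f | helmholtz m%:R f].

Lemma helmholtz_ball_nonempty m : helmholtz_ball m !=set0.
Proof. by exists Hk0; exact: helmholtz0. Qed.

Lemma FP_helmholtz_ball m : FP k `<=` helmholtz_ball m.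
Proof. by move=> f [sf hf]; split=> [|x _]; [exact: sub_smooth sf|exact: hf]. Qed.

(** At distance 0 from the solutions in the ball of radius [m], [f] is a uniform limit of them
    there, hence a solution; the balls exhaust the space. *)
Lemma setdist_helmholtz_ball_eq0 f :
  (forall m, setdist (helmholtz_ball m) f = 0) -> FP k f.
Proof.
move=> f0.
have hf m : helmholtz m%:R f.
  apply: helmholtz_limit_helmholtz => e e0.
  have m0 : 0 < (m.+1%:R : R)^-1 by rewrite invr_gt0.
  (* A distance less than 1/(m + 1) means closeness on a ball of radius greater than m + 1, which
     contains the ball of radius [m]. *)
  have [||g gm fg] := @setdist_lt R _ (helmholtz_ball m) f (Num.min e m.+1%:R^-1).
  - exact: helmholtz_ball_nonempty.
  - by rewrite f0 lt_min e0.
  exists g => // x xm; have [r fgr] := dk_lt fg.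
  rewrite lt_min => /andP[re rm]; have [M Mr fgM] := dk_set_bound fgr.
  apply: le_trans (ltW (lt_trans Mr re)); apply: (fgM [::] x) => //.
  have [r0 _] := fgr; apply: lt_trans (xm : enorm x < m%:R) _.
  have : (m.+1%:R : R) < r^-1.
    by rewrite -(invrK m.+1%:R) ltf_pV2 ?posrE.
  by apply: lt_trans; rewrite ltr_nat.
have big (x : 'rV[R]_d) : exists m : nat, eball m%:R x.
  exists (Num.truncn (enorm x)).+1.
  by rewrite /eball/= truncnS_gt.
split=> [|x]; last by have [m xm] := big x; exact: (hf m).2.
apply/smoothP => s x _; have [m xm] := big x.
by have [/smoothP/(_ s x xm)] := hf m.
Qed.

Definition helmholtz_defect (m : nat) f : R :=
  Num.min 1 (m%:R * setdist (helmholtz_ball m) f).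

Lemma helmholtz_defect_continuous m : continuous (helmholtz_defect m).
Proof.
move=> f; apply: (@continuous_min _ _ (fun=> 1) (fun f => m%:R * setdist (helmholtz_ball m) f)).
  exact: cst_continuous.
apply: continuousM; first exact: cst_continuous.
by apply: continuous_setdist; exact: helmholtz_ball_nonempty.
Qed.

Lemma helmholtz_defect_itv m f : 0 <= helmholtz_defect m f <= 1.
Proof.
rewrite ge_min lexx andbT le_min ler01 mulr_ge0//.
exact/setdist_ge0/helmholtz_ball_nonempty.
Qed.

Lemma helmholtz_defect_eq0 m f : helmholtz_ball m f -> helmholtz_defect m f = 0.
Proof. by move=> fm; rewrite /helmholtz_defect setdist0// mulr0 min_r. Qed.

Lemma setdist_helmholtz_ball_nd f m n : (m <= n)%N ->
  setdist (helmholtz_ball m) f <= setdist (helmholtz_ball n) f.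
Proof.
move=> mn; apply: le_setdist; first exact: helmholtz_ball_nonempty.
by move=> g; apply: sub_helmholtz; rewrite ler_nat.
Qed.

Lemma helmholtz_defect_nd f : nondecreasing_seq (helmholtz_defect ^~ f).
Proof.
move=> m n mn; rewrite le_min ge_min lexx/= ge_min; apply/orP; right.
rewrite ler_pM//; last exact: setdist_helmholtz_ball_nd.
  exact/setdist_ge0/helmholtz_ball_nonempty.
by rewrite ler_nat.
Qed.

(** Exhibits the complement as a countable union of sets that are open by continuity of the
    distances, whence its measurability. *)
Lemma setC_FP : ~` (FP k : set (Hk R d k)) =
  \bigcup_m [set f | 0 < setdist (helmholtz_ball m) f].
Proof.
apply/seteqP; split=> [f nf|f [m _ /= fm] /FP_helmholtz_ball fF].
  apply: contrapT => nm; apply: nf; apply: setdist_helmholtz_ball_eq0 => m.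
  apply/eqP; rewrite eq_le setdist_ge0 ?andbT; last exact: helmholtz_ball_nonempty.
  by rewrite leNgt; apply/negP => fm; apply: nm; exists m.
by move: fm; rewrite setdist0 ?ltxx.
Qed.

Lemma measurable_setC_FP : measurable (~` (FP k : set (Hk R d k))).
Proof.
rewrite setC_FP; apply: bigcupT_measurable => m; apply: sub_sigma_algebra.
apply: (@open_comp _ _ (setdist (helmholtz_ball m)) [set x | 0 < x]); last exact: open_gt.
by move=> f _; apply: continuous_setdist; exact: helmholtz_ball_nonempty.
Qed.

Lemma cvg_helmholtz_defect f : helmholtz_defect n f @[n --> \oo] --> (\1_(~` FP k) f : R).
Proof.
rewrite indicE; have [Ff|nF] := pselect (FP k f).
  rewrite memNset; last by rewrite /= not_notE.
  apply: cvg_near_cst; near=> n; apply: helmholtz_defect_eq0.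
  exact: FP_helmholtz_ball.
rewrite mem_set//; have : (~` FP k) f by [].
rewrite setC_FP => -[m _ /= fm]; apply: cvg_near_cst.
(* From this index on, the distance to the [n]-th set is at least the positive distance to the
   [m]-th one, and n times the latter is at least 1, so the minimum is 1. *)
exists (maxn m (Num.truncn (setdist (helmholtz_ball m) f)^-1).+1) => // n /=.
rewrite geq_max => /andP[mn cn]; rewrite /helmholtz_defect min_l//.
have c0 : 0 < setdist (helmholtz_ball m) f := fm.
apply: (@le_trans _ _ (n%:R * setdist (helmholtz_ball m) f)).
  rewrite -ler_pdivrMr// mul1r (le_trans (ltW (truncnS_gt _)))// ler_nat//.
by rewrite ler_wpM2l// setdist_helmholtz_ball_nd.
Unshelve. all: by end_near. Qed.

End Hk_functionals.

(** * From vanishing integrals to a null set of a signed measure *)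

Section charges.
Local Open Scope ereal_scope.
Context d (T : measurableType d) (R : realType).

Lemma integral_cvg_indic (mu : {finite_measure set T -> \bar R})
    (F : nat -> T -> R) (B : set T) :
  measurable B -> (forall n, measurable_fun setT (F n)) ->
  (forall n x, (0 <= F n x <= 1)%R) -> (forall x, nondecreasing_seq (F ^~ x)) ->
  (forall x, F n x @[n --> \oo] --> (\1_B x : R)) ->
  \int[mu]_x (F n x)%:E @[n --> \oo] --> mu B.
Proof.
move=> mB mF F01 ndF cF.
have := @cvg_monotone_convergence _ T R mu setT measurableT (fun n x => (F n x)%:E).
have -> : (fun x => limn (fun n => (F n x)%:E)) = (fun x => (\1_B x)%:E).
  apply/funext => x; apply/cvg_lim => //.
  by apply: cvg_EFin; [exact: nearW|exact: cF].
rewrite integral_indic// setIT; apply.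
- by move=> n; apply/measurable_realfun.measurable_EFinP.
- by move=> n x _; rewrite lee_fin; case/andP: (F01 n x).
- by move=> x _ m n mn; rewrite lee_fin; exact: ndF.
Qed.

Lemma integral_fin_num (mu : {finite_measure set T -> \bar R}) (F : T -> R) :
  measurable_fun setT F -> (forall x, (0 <= F x <= 1)%R) ->
  \int[mu]_x (F x)%:E \is a fin_num.
Proof.
move=> mF F01.
have F0 x : 0 <= (F x)%:E by rewrite lee_fin; case/andP: (F01 x).
rewrite ge0_fin_numE ?integral_ge0//.
apply: (@le_lt_trans _ _ (\int[mu]_x (cst 1 x))).
  apply: ge0_le_integral => //; first exact/measurable_realfun.measurable_EFinP.
  by move=> x _; rewrite lee_fin; case/andP: (F01 x).
rewrite integral_cst// mul1e ltey_eq.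
by rewrite fin_num_measure.
Qed.

(** The two Jordan parts give each [F n] the same finite integral, hence by monotone convergence the
    same mass to [B]; this mass is finite, so it cancels. *)
Lemma charge_eq0_of_integrals (nu : {charge set T -> \bar R})
    (F : nat -> T -> R) (B : set T) :
  measurable B -> (forall n, measurable_fun setT (F n)) ->
  (forall n x, (0 <= F n x <= 1)%R) -> (forall x, nondecreasing_seq (F ^~ x)) ->
  (forall x, F n x @[n --> \oo] --> (\1_B x : R)) ->
  (forall n, charge_integral nu (F n) = 0) -> nu B = 0.
Proof.
move=> mB mF F01 ndF cF; rewrite /charge_integral.
set hahn := svalP _; set nuPN := svalP _ => nuF.
have cpos := @integral_cvg_indic (jordan_pos nuPN) F B mB mF F01 ndF cF.
have cneg := @integral_cvg_indic (jordan_neg nuPN) F B mB mF F01 ndF cF.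
have E n : \int[jordan_pos nuPN]_x (F n x)%:E = \int[jordan_neg nuPN]_x (F n x)%:E.
  have fp := @integral_fin_num (jordan_pos nuPN) (F n) (mF n) (F01 n).
  have fn := @integral_fin_num (jordan_neg nuPN) (F n) (mF n) (F01 n).
  by have /eqP := nuF n; rewrite sube_eq ?add0e ?fin_num_adde_defl// => /eqP.
have PN : jordan_pos nuPN B = jordan_neg nuPN B.
  by rewrite -(cvg_lim _ cpos)// (funext E); exact: cvg_lim.
rewrite (jordan_decomp nuPN mB) /cadd/= cscaleN1 /=.
rewrite -[X in X + _]/(jordan_pos nuPN B) -[X in _ - X]/(jordan_neg nuPN B) PN subee//.
exact: fin_num_measure.
Qed.

End charges.

(** * Localized eigenfunctions and their local measures *)

Section localized_eigenfunctions.
Context {R : realType} {d : nat}.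
Implicit Types (Omega U : set 'rV[R]_d) (phi : 'rV[R]_d -> R) (x y z : 'rV[R]_d)
  (h r rho : R).

(** Two derivatives in [y] bring out the factor h^2 of the eigenvalue equation. *)
Lemma helmholtz_rescaled Omega phi h x r : open Omega -> smooth Omega phi ->
  (forall z, Omega z -> - (h ^+ 2 * laplacian phi z) = phi z) ->
  (forall y, eball r y -> Omega (x + h *: y)) ->
  helmholtz r (fun y => phi (x + h *: y)).
Proof.
move=> oO sphi ephi xO; split=> [|y /xO Oy].
  exact: sub_smooth (smooth_affine x h oO sphi).
apply: etrans (ephi _ Oy); congr (- _); rewrite /laplacian mulr_sumr.
by apply: eq_bigr => i _; exact: (pderivs_affine [:: i; i] oO sphi Oy).
Qed.

(* The infimum of an empty set is 0, whence the first alternative; it is harmless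
   because the argument of the cutoff is then a division by 0, that is 0. *)
Lemma dist_boundary_ge Omega x rho : open Omega ->
  (forall z, `|z - x| < rho -> Omega z) ->
  dist_boundary Omega x = 0 \/ rho <= dist_boundary Omega x.
Proof.
move=> oO xO; have [[z bz]|/set0P/negP/negPn/eqP b0] := pselect (boundary Omega !=set0).
  right; apply: lb_le_inf; first by exists (enorm (x - z)), z.
  (* An open set is its own interior, so a boundary point is outside [Omega], hence at sup distance,
     a fortiori at Euclidean distance, at least [rho]. *)
  move=> _ [w [_ nw] <-]; rewrite leNgt; apply/negP => xw; apply: nw.
  rewrite (interior_id _).1//; apply: xO.
  by apply: le_lt_trans xw; rewrite distrC; exact: norm_le_enorm.
by left; rewrite /dist_boundary b0 image_set0 inf0.
Qed.

(** For |y| < r, the bound h r < rho keeps x + h y in [Omega], and h r < e rho keeps the argument of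
    [chi] below [e], where [chi] is 1. *)
Lemma helmholtz_localized (chi : R -> R) Omega phi h x r rho e : open Omega ->
  smooth Omega phi ->
  (forall z, Omega z -> - (h ^+ 2 * laplacian phi z) = phi z) ->
  0 < e -> (forall t, 0 <= t < e -> chi t = 1) ->
  0 < h -> 0 < rho -> (forall z, `|z - x| < rho -> Omega z) ->
  h * r < rho -> h * r < e * rho ->
  helmholtz r (localized chi Omega phi h x).
Proof.
move=> oO sphi ephi e0 chi1 h0 rho0 xO hr_rho hr_erho.
have hy y : eball r y -> h * enorm y < h * r by move=> yr; rewrite ltr_pM2l.
have in_Omega y : eball r y -> Omega (x + h *: y).
  move=> yr; apply: xO; rewrite addrC addKr normrZ gtr0_norm//.
  apply: le_lt_trans (lt_trans (hy y yr) hr_rho).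
  by rewrite ler_pM2l// norm_le_enorm.
apply: eq_helmholtz (helmholtz_rescaled oO sphi ephi in_Omega) => y yr.
rewrite /localized chi1 ?mulr1//.
have hy0 : 0 <= h * enorm y by rewrite mulr_ge0 ?sqrtr_ge0// ltW.
have [->|rhod] := dist_boundary_ge oO xO; first by rewrite invr0 mulr0 lexx.
have d0 : 0 < dist_boundary Omega x by exact: lt_le_trans rhod.
rewrite divr_ge0// ?(ltW d0)//= ltr_pdivrMr//.
by apply: lt_le_trans (lt_trans (hy y yr) hr_erho) _; rewrite ler_pM2l.
Qed.

(** The default value of [insubd] is 0, itself a solution, so both cases are covered. *)
Lemma to_Hk_helmholtz_ball k m (f : 'rV[R]_d -> R) : helmholtz m%:R f ->
  helmholtz_ball m (to_Hk k f).
Proof.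
move=> hf; rewrite /helmholtz_ball/= /to_Hk.
rewrite -[Hk_fun _]/(val _) val_insubd; case: ifP => // _.
exact: helmholtz0.
Qed.

(** A sup-norm neighbourhood of the complement; as a union of open balls it is open, hence Borel. *)
Definition boundary_layer Omega (p : nat) : set 'rV[R]_d :=
  \bigcup_(z in ~` Omega) ball z p.+1%:R^-1.

Lemma measurable_boundary_layer Omega p : measurable (boundary_layer Omega p).
Proof.
by apply: sub_sigma_algebra; apply: bigcup_open => z _; exact: ball_open.
Qed.

Lemma notin_boundary_layer Omega p x : ~ boundary_layer Omega p x ->
  forall z, `|z - x| < p.+1%:R^-1 -> Omega z.
Proof.
move=> nx z zx; apply: contrapT => nz; apply: nx; exists z => //.
by rewrite -ball_normE.
Qed.

(** Continuity from above, [U] having finite measure: the layers decrease, and their intersection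
    misses [Omega] because each point of an open set is the centre of a ball inside it. *)
Lemma boundary_layer_cvg0 Omega U (mu : {measure set 'rV[R]_d -> \bar R}) :
  open Omega -> U `<=` Omega -> measurable U -> (mu U < +oo)%E ->
  mu (U `&` boundary_layer Omega p) @[p --> \oo] --> 0%E.
Proof.
move=> oO UO mU Uoo.
have mUp p : measurable (U `&` boundary_layer Omega p).
  by apply: measurableI => //; exact: measurable_boundary_layer.
have cap0 : \bigcap_p (U `&` boundary_layer Omega p) = set0.
  rewrite -subset0 => x xU; have [Ux _] := xU 0%N Logic.I.
  have /near_dist[r r0 rO] : \forall y \near x, Omega y.
    by apply: open_nbhs_nbhs; split => //; exact: UO.
  have [_ [z nz]] := xU (Num.truncn r^-1) Logic.I.
  rewrite -ball_normE /= => zx; apply: nz; apply: rO; rewrite distrC.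
  apply: lt_trans zx _; rewrite -[ltRHS]invrK ltf_pV2 ?posrE ?invr_gt0//.
  exact: truncnS_gt.
rewrite -(measure0 mu) -cap0; apply: nonincreasing_cvg_mu => //.
- apply: le_lt_trans Uoo; apply: le_measure; rewrite ?inE//.
- by rewrite cap0.
- move=> p q pq; apply/subsetPset; apply: setIS => x [z nz zx]; exists z => //.
  by apply: le_ball zx; rewrite lef_pV2 ?posrE// ler_nat.
Qed.

End localized_eigenfunctions.

(** * The defects integrate to 0 against an accumulation point *)

Section local_measure_limits.
Context {R : realType} {d : nat}.
Variables (chi : R -> R) (Omega U : set 'rV[R]_d).
Variables (phi : nat -> 'rV[R]_d -> R) (h : nat -> R).
Hypotheses (chi_cutoff : cutoff chi) (Omega_open : open Omega).
Hypotheses (phi_smooth : forall n, smooth Omega (phi n)).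
Hypotheses (h_gt0 : forall n, 0 < h n) (h_cvg : h @ \oo --> 0).
Hypothesis phi_eigen :
  forall n x, Omega x -> - (h n ^+ 2 * laplacian (phi n) x) = phi n x.
Hypotheses (U_sub : U `<=` Omega) (U_borel : measurable U).

(** Off the layer [B] the localized functions lie in [helmholtz_ball m] once h_n is small, so the
    integral is at most [c] times the measure of [B], which is small for [p] large. *)
Lemma integral_LM_helmholtz_defect k m (e : R) : 0 < e ->
  exists N, forall n, (N <= n)%N ->
  (0 <= \int[LM k U chi Omega (phi n) (h n)]_f (helmholtz_defect m f)%:E <= e%:E)%E.
Proof.
move=> e0; pose c := (fine (lebesgue_rV d U))^-1.
have c0 : 0 <= c by rewrite invr_ge0 fine_ge0.
have [Uoo|Uoo] := eqVneq (lebesgue_rV d U) +oo%E.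
  (* then c = (fine +oo)^-1 = 0 *)
  exists 0%N => n _.
  have := @integral_average_dirac _ _ _ (Hk R d k) R (lebesgue_rV d) c U
    (fun x => to_Hk k (localized chi Omega (phi n) (h n) x)) c0
    (helmholtz_defect m) setT measurableT (helmholtz_defect_itv m).
  move=> /(_ (fun _ _ nT => False_ind _ (nT Logic.I)))/andP[I0 Ile].
  apply/andP; split; first exact: I0.
  by apply: le_trans Ile _; rewrite /c Uoo /= invr0 mul0e lee_fin ltW.
have Ufin : (lebesgue_rV d U < +oo)%E by rewrite lt_neqAle Uoo leey.
(* The denominator is c + 1 because [c] is only known to be nonnegative. *)
have [p pU] : exists p, (lebesgue_rV d (U `&` boundary_layer Omega p) < (e / (c + 1))%:E)%E.
  have /= := @boundary_layer_cvg0 _ _ _ _ (lebesgue_rV d) Omega_open U_sub U_borel Ufin.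
  move=> /(_ [set y | (y < (e / (c + 1))%:E)%E]) [].
    apply: open_nbhs_nbhs; split; first exact: open_ereal_lt_ereal.
    by rewrite /= lte_fin divr_gt0// ltr_wpDl.
  by move=> p _ /(_ p (leqnn p)) /= ?; exists p.
have [_ _ [a a0 chi1] _ _] := chi_cutoff.
pose rho : R := p.+1%:R^-1.
have rho0 : 0 < rho by rewrite invr_gt0.
(* Dividing by m + 1 allows m = 0 and yields strict bounds on h_n m. *)
have q0 : 0 < Num.min rho (a * rho) / m.+1%:R.
  by rewrite divr_gt0// lt_min rho0 mulr_gt0.
have [N _ hN] : \forall n \near \oo, h n < Num.min rho (a * rho) / m.+1%:R.
  exact: cvgr_lt h_cvg _ q0.
exists N => n /hN /=; rewrite ltr_pdivlMr// lt_min => /andP[h1 h2].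
have hm : h n * m%:R < h n * m.+1%:R by rewrite ltr_pM2l// ltr_nat.
pose B := U `&` boundary_layer Omega p.
have mB : measurable B by apply: measurableI => //; exact: measurable_boundary_layer.
pose T x := to_Hk k (localized chi Omega (phi n) (h n) x).
have FB x : U x -> ~ B x -> helmholtz_defect m (T x) = 0.
  move=> Ux nB; apply: helmholtz_defect_eq0; apply: to_Hk_helmholtz_ball.
  apply: (@helmholtz_localized _ _ chi Omega (phi n) (h n) x m%:R rho a) => //.
  - exact: phi_eigen.
  - by apply: notin_boundary_layer => lx; apply: nB.
  - exact: lt_trans h1.
  - exact: lt_trans h2.
have := @integral_average_dirac _ _ _ (Hk R d k) R (lebesgue_rV d) c U T c0
  (helmholtz_defect m) B mB (helmholtz_defect_itv m) FB.
move=> /andP[I0 Ile]; apply/andP; split; first exact: I0.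
apply: le_trans Ile _; apply: (@le_trans _ _ (c%:E * (e / (c + 1))%:E)%E).
  by rewrite lee_wpmul2l ?lee_fin// ltW.
have c1 : 0 < c + 1 by rewrite ltr_wpDl.
by rewrite -EFinM lee_fin mulrCA ger_pMr// ler_pdivrMr// mul1r lerDl.
Qed.

Lemma charge_integral_helmholtz_defect k m (mu : {charge set (Hk R d k) -> \bar R}) :
  sigma_LM k U chi Omega phi h mu ->
  charge_integral mu (helmholtz_defect m) = 0%E.
Proof.
move=> mu_sigma.
have bF : bounded_fun (@helmholtz_defect R d k m).
  exists 1; split; first exact: num_real.
  move=> M M1 f _ /=; have /andP[F0 F1] := helmholtz_defect_itv m f.
  by rewrite ger0_norm// (le_trans F1)// ltW.
have key (e : R) : 0 < e -> (`|charge_integral mu (helmholtz_defect m)| <= (2 * e)%:E)%E.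
  move=> e0; have [N HN] := integral_LM_helmholtz_defect k m e0.
  have [|n Nn /(_ ord0)] := mu_sigma 1%N (fun=> helmholtz_defect m) e N _ e0.
    by move=> _; split; [exact: helmholtz_defect_continuous|].
  have := HN n Nn; set I := integral _ _ _; case: I => [a||].
  - rewrite !lee_fin => /andP[a0 ae].
    case: (charge_integral _ _) => [b||]; rewrite //= !lte_fin lee_fin => ab.
    rewrite (_ : b = a - (a - b)); last by ring.
    rewrite (le_trans (ler_normB _ _))// (ger0_norm a0); lra.
  - by rewrite leye_eq andbF.
  - by rewrite leeNy_eq.
(* The bound for all e > 0 forces a finite value to be 0 and excludes the infinite ones. *)
move: key; case: (charge_integral _ _) => [b||] key.
- congr EFin; apply/eqP; rewrite -normr_eq0 eq_le normr_ge0 andbT.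
  apply/ler_addgt0Pl => e e0; rewrite addr0.
  have e2 : 0 < e / 2 by rewrite divr_gt0.
  by have := key _ e2; rewrite lee_fin mulrC divfK.
- by have := key 1 ltr01; rewrite /= leye_eq.
- by have := key 1 ltr01; rewrite /= leye_eq.
Qed.

End local_measure_limits.

Theorem lemma2 (R : realType) (d : nat) (d_gt0 : (0 < d)%N)
  (chi : R -> R) (chi_cutoff : cutoff chi)
  (Omega : set 'rV[R]_d)
  (Omega_open : open Omega) (Omega_bounded : bounded_set Omega)
  (phi : nat -> 'rV[R]_d -> R) (h : nat -> R)
  (phi_smooth : forall n, smooth Omega (phi n))
  (h_gt0 : forall n, 0 < h n)
  (h_cvg : h @ \oo --> 0)
  (phi_eigen : forall n x, Omega x -> - (h n ^+ 2 * laplacian (phi n) x) = phi n x)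
  (phi_dirichlet : forall n, H10 Omega (phi n))
  (phi_norm : forall n,
    (\int[lebesgue_rV d]_(x in Omega) ((phi n x) ^+ 2)%:E)%E
      = lebesgue_rV d Omega)
  (U : set 'rV[R]_d) (U_sub : U `<=` Omega) (U_borel : measurable U)
  (U_pos : (0%:E < lebesgue_rV d U)%E)
  (k : nat) (mu : {charge set (Hk R d k) -> \bar R})
  (mu_sigma : sigma_LM k U chi Omega phi h mu) :
  mu (~` FP k) = 0%E.
Proof.
apply: (@charge_eq0_of_integrals _ _ _ mu (fun m => helmholtz_defect m)).
- exact: measurable_setC_FP.
- by move=> m; apply: continuous_measurable_Hk; exact: helmholtz_defect_continuous.
- exact: helmholtz_defect_itv.
- exact: helmholtz_defect_nd.
- exact: cvg_helmholtz_defect.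
- move=> m; exact: (charge_integral_helmholtz_defect chi_cutoff Omega_open
    phi_smooth h_gt0 h_cvg phi_eigen U_sub U_borel m mu_sigma).
Qed.
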